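(* Let $F$ be a once-punctured torus equipped with a point of the decorated super Teichmüller space $S\tilde T(F)$ with values in the Grassmann algebra $\mathbb{R}_{S[N]}$, and let $h$ be its super semi-perimeter. Then \[ \sum_{a}\left(\frac{1}{a\,h\,r_a}+\frac{W_a}{2ah}\right)=\frac12, \] where the sum runs over all ideal arcs of $F$ (with $a$ also denoting the $\lambda$-length of the arc) and $r_a=\tfrac12\big(ah-W_a+\sqrt{(ah-W_a)^2-4}\big)$.
   Context: $\mathbb{R}_{S[N]}$ is the real Grassmann algebra generated by anticommuting $\beta_{[1]},\dots,\beta_{[N]}$; $x=\sum_\lambda x_\lambda\beta_{[\lambda]}$, body $\epsilon(x)$ = coefficient of $1$, norm $\|x\|=\sum|x_\lambda|$; functions of even elements with positive body (inverses, square roots) are defined by Taylor expansion about the body; convergence is in this norm. $S\tilde T(F)$ is the decorated $\mathrm{OSp}(1|2)$ super Teichmüller space (Penner–Zeitlin). A point assigns, for each ideal triangulation of $F$ (three disjoint non-isotopic ideal arcs cutting $F$ into two ideal triangles), an even $\lambda$-length with positive body to each arc (depending only on the arc), an odd $\mu$-invariant to each triangle, and a spin structure orienting each arc. For an ideal arc $e$, $W_e=\theta_1\theta_2$ where $\theta_1,\theta_2$ are the $\mu$-invariants of the triangles adjacent to $e$ counter-clockwise and clockwise of $e$ relative to its spin orientation (independent of the triangulation containing $e$). For a triangulation with $\lambda$-lengths $a,b,c$, the super semi-perimeter is $h=\frac{a}{bc}+\frac{b}{ac}+\frac{c}{ab}+\frac{W_a}{a}+\frac{W_b}{b}+\frac{W_c}{c}$,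 independent of the triangulation. *)

(* Defs.v *)
From Stdlib Require Import Reals.
From HB Require Import structures.
From mathcomp Require Import all_boot all_order all_algebra.
From mathcomp Require Import Rstruct.
Set Implicit Arguments. Unset Strict Implicit. Unset Printing Implicit Defensive.
Import Order.TTheory GRing.Theory Num.Theory.
Local Open Scope ring_scope.

(* An element is x = sum_S x_S beta_[S], S ranging over subsets of {1..N},
   beta_[S] the product of the generators in S in increasing order. *)
Definition grass (N : nat) := {ffun {set 'I_N} -> R}.

Definition gconst N (c : R) : grass N := [ffun S => if S == set0 then c else 0].
Definition gadd N (x y : grass N) : grass N := [ffun S => x S + y S].
Definition gopp N (x : grass N) : grass N := [ffun S => - x S].
Definition gscale N (c : R) (x : grass N) : grass N := [ffun S => c * x S].

(* sign of beta_[A] beta_[B] = gsgn A B * beta_[A :|: B] for disjoint A, B *)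
Definition gsgn N (A B : {set 'I_N}) : R :=
  (-1) ^+ #|[set p : 'I_N * 'I_N | (p.1 \in A) && (p.2 \in B) && (p.2 < p.1)%N]|.

Definition gmul N (x y : grass N) : grass N :=
  [ffun S => \sum_(A : {set 'I_N}) \sum_(B : {set 'I_N} | (A :|: B == S) && [disjoint A & B])
              gsgn A B * x A * y B].

Definition gpow N (x : grass N) (k : nat) : grass N := iter k (gmul x) (gconst N 1).
Definition gsum N (s : seq (int * int)) (f : int * int -> grass N) : grass N :=
  foldr (fun v acc => gadd (f v) acc) (gconst N 0) s.

Definition gbody N (x : grass N) : R := x set0.
Definition gsoul N (x : grass N) : grass N := gadd x (gconst N (- gbody x)).
Definition grnorm N (x : grass N) : R := \sum_(S : {set 'I_N}) `|x S|.
Definition geven N (x : grass N) : Prop := forall S : {set 'I_N}, odd #|S| -> x S = 0.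
Definition godd N (x : grass N) : Prop := forall S : {set 'I_N}, ~~ odd #|S| -> x S = 0.

(* Taylor expansion about the body: sum_k c_k (x - body x)^k; the soul is
   nilpotent of order <= N+1, so the sum up to k = N is the full series. *)
Definition taylor N (c : nat -> R) (x : grass N) : grass N :=
  \big[@gadd N/gconst N 0]_(k < N.+1) gscale (c k) (gpow (gsoul x) k).

(* 1/t : f^(k)(t0)/k! = (-1)^k / t0^(k+1) *)
Definition ginv N (x : grass N) : grass N :=
  taylor (fun k => (-1) ^+ k / (gbody x) ^+ k.+1) x.

Definition binom_half (k : nat) : R :=
  (\prod_(j < k) (1 / 2 - (j%:R : R))) / (k`!)%:R.

(* sqrt t : f^(k)(t0)/k! = sqrt t0 * binom(1/2,k) / t0^k *)
Definition gsqrt N (x : grass N) : grass N :=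
  taylor (fun k => sqrt (gbody x) * binom_half k / (gbody x) ^+ k) x.

(* F = (R^2 \ Z^2)/Z^2; ideal arcs <-> slopes in Q u {oo}, represented by
   primitive integer vectors (p,q) normalized by q > 0, or (p,q) = (1,0). *)
Definition arcb (v : int * int) : bool :=
  (gcdz v.1 v.2 == 1) && ((0 < v.2) || ((v.2 == 0) && (v.1 == 1))).

Definition nrm (v : int * int) : int * int :=
  if (v.2 < 0) || ((v.2 == 0) && (v.1 < 0)) then (- v.1, - v.2) else v.

Definition vdet (u v : int * int) : int := u.1 * v.2 - u.2 * v.1.
Definition vadd (u v : int * int) : int * int := (u.1 + v.1, u.2 + v.2).
Definition vsub (u v : int * int) : int * int := (u.1 - v.1, u.2 - v.2).

(* two arcs are disjoint (and distinct) iff |det| = 1; three pairwise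
   such arcs form an ideal triangulation *)
Definition adjacent (u v : int * int) : bool := `|vdet u v| == 1.
Definition triangulation (a b c : int * int) : Prop :=
  [/\ arcb a, arcb b, arcb c & [/\ adjacent a b, adjacent b c & adjacent a c]].

(* W_e = theta_1 theta_2: on the torus both triangles are adjacent to every
   arc, so W_e = +- mu1 mu2, the sign given by the spin structure, which
   depends only on the class of e in H_1(F;Z/2) = (Z/2)^2. *)
Definition Wof N (mu1 mu2 : grass N) (spin : bool -> bool -> bool)
  (v : int * int) : grass N :=
  if spin (odd `|v.1|%N) (odd `|v.2|%N) then gmul mu1 mu2 else gopp (gmul mu1 mu2).

(* lambda-lengths of all arcs, mu-invariants mu1 mu2 of the two triangles of
   a reference triangulation (only their product, invariant under flips,
   enters W), spin structure; super Ptolemy relation at every flip: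
   for the triangulation {b, c, b+c} flipped to {b, c, b-c}:
   lambda(b+c) lambda(b-c) = lambda(b)^2 + lambda(c)^2 + lambda(b)lambda(c) W_{b+c}. *)
Record STT (N : nat) := MkSTT {
  lam : int * int -> grass N;
  mu1 : grass N;
  mu2 : grass N;
  spin : bool -> bool -> bool;
  lam_even : forall v, arcb v -> geven (lam v);
  lam_pos : forall v, arcb v -> 0 < gbody (lam v);
  mu1_odd : godd mu1;
  mu2_odd : godd mu2;
  ptolemy : forall b c, arcb b -> arcb c -> adjacent b c ->
    gmul (lam (nrm (vadd b c))) (lam (nrm (vsub b c))) =
    gadd (gadd (gmul (lam b) (lam b)) (gmul (lam c) (lam c)))
         (gmul (gmul (lam b) (lam c)) (Wof mu1 mu2 spin (nrm (vadd b c))))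
}.

Definition Wa N (P : STT N) (v : int * int) : grass N :=
  Wof (mu1 P) (mu2 P) (spin P) v.

Definition gfrac3 N (a x y : grass N) : grass N := gmul a (ginv (gmul x y)).

Definition superh N (P : STT N) (a b c : int * int) : grass N :=
  let la := lam P a in let lb := lam P b in let lc := lam P c in
  gadd (gadd (gadd (gfrac3 la lb lc) (gfrac3 lb la lc)) (gfrac3 lc la lb))
       (gadd (gadd (gmul (Wa P a) (ginv la)) (gmul (Wa P b) (ginv lb)))
             (gmul (Wa P c) (ginv lc))).

Definition r_arc N (P : STT N) (h : grass N) (a : int * int) : grass N :=
  let x := gadd (gmul (lam P a) h) (gopp (Wa P a)) in
  gscale (1 / 2) (gadd x (gsqrt (gadd (gmul x x) (gconst N (-4))))).

Definition mcshane_term N (P : STT N) (h : grass N) (a : int * int) : grass N :=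
  gadd (ginv (gmul (gmul (lam P a) h) (r_arc P h a)))
       (gmul (Wa P a) (ginv (gscale 2 (gmul (lam P a) h)))).

(* Main.v *)
(** Put X_v = λ(v)h for an arc v (a primitive vector up to sign) and, for
    adjacent b, c,
      Φ(b,c) = λ(b-c)/(λ(b)λ(c)h) + W_b/(2λ(b)h) + W_c/(2λ(c)h).
    The super Ptolemy relation makes Φ a finitely additive measure on Farey
    intervals, Φ(b,c) = Φ(b,b+c) + Φ(b+c,c), of total mass
    Φ(b,c) + Φ(b,-c) = 1, and the summand of the theorem, α(v), is the mass that
    the atom v contributes to an interval ending at v.  Hence
    G(b,c) = Φ(b,c) - α(b) - α(c) satisfies G(b,c) = G(b,b+c) + G(b+c,c) + 2α(b+c),
    and the claim is that the G of the n-th Farey subdivision add up to o(1).  In the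
    code α, G, 1/X_v and 1/(X_v r_v) are [alpha], [gap], [slen v] and [atom v].

    Everything happens in the commutative ring of even elements, with the
    weighted norms ‖x‖_t = Σ_S t^|S| |x_S|: for t small the souls are negligible,
    so strict inequalities between bodies become inequalities between norms.
    At a sink of the flip graph (body-wise) and for t small,
    ψ(b,c) = 1 - λ(b+c)/(λ(b)λ(c)h) has norm at most slightly more than 1/2 on the
    three Farey intervals of the triangulation, and ‖1/X_v‖ < 1/2; these bounds are
    inherited by subdivision because
      1/X_(b+c) = (1/X_b)(1/X_c)(1-ψ(b,c))⁻¹,
      ψ(b,b+c) = X_b⁻² (1-ψ(b,c))⁻¹ + W_b/X_b + W_(b+c)/X_(b+c).
    It follows that ‖G(b,c)‖ is bounded by a multiple of ‖1/X_b‖ ‖1/X_c‖, whose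
    sum over the n-th subdivision decays geometrically; the same bound gives
    absolute convergence. *)
Require Import Defs.
From Stdlib Require Import Reals.
From HB Require Import structures.
From mathcomp Require Import all_boot all_order all_algebra.
From mathcomp Require Import Rstruct ring lra zify.
Set Implicit Arguments. Unset Strict Implicit. Unset Printing Implicit Defensive.
Import Order.TTheory GRing.Theory Num.Theory.
Local Open Scope ring_scope.
Bind Scope ring_scope with R.

(** * The ring of even elements *)

Section GrassmannProduct.
Variable N : nat.
Implicit Types (A B C D S : {set 'I_N}) (x y z : grass N).

Lemma gsgnUl A B C : [disjoint A & B] ->
  gsgn (A :|: B) C = gsgn A C * gsgn B C.
Proof.
move=> dAB; rewrite /gsgn -exprD; congr (_ ^+ _).
set T := [set p | _]; set U := [set p | _]; set V := [set p | _].
suff UV0 : U :&: V = set0.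
  rewrite -[RHS]cardsUI UV0 cards0 addn0.
  by apply: eq_card => -[i j]; rewrite !inE /= !andb_orl.
apply/setP => -[i j]; rewrite !inE /=; apply/negP.
case/andP=> /andP[/andP[iA _] _] /andP[/andP[iB _] _].
by have := disjointFr dAB iA; rewrite iB.
Qed.

Lemma gsgnUr A B C : [disjoint B & C] ->
  gsgn A (B :|: C) = gsgn A B * gsgn A C.
Proof.
move=> dBC; rewrite /gsgn -exprD; congr (_ ^+ _).
set T := [set p | _]; set U := [set p | _]; set V := [set p | _].
suff UV0 : U :&: V = set0.
  rewrite -[RHS]cardsUI UV0 cards0 addn0.
  by apply: eq_card => -[i j]; rewrite !inE /= andb_orr andb_orl.
apply/setP => -[i j]; rewrite !inE /=; apply/negP.
case/andP=> /andP[/andP[_ jB] _] /andP[/andP[_ jC] _].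
by have := disjointFr dBC jB; rewrite jC.
Qed.

(** The inversions of (A, B) and the transposed inversions of (B, A) partition A x B, so the two
    exponents add up to |A||B|, which is even. *)
Lemma gsgnC A B : [disjoint A & B] -> ~~ odd #|A| -> gsgn A B = gsgn B A.
Proof.
move=> dAB eA; rewrite /gsgn -signr_odd -[RHS]signr_odd; congr (_ ^+ nat_of_bool _).
set U := [set p | _]; set V := [set p | _].
have -> : #|V| = #|[set (p.2, p.1) | p in V]|.
  by rewrite card_imset // => -[i j] [k l] [-> ->].
set V' := imset _ _.
have UV : U :&: V' = set0.
  apply/setP => -[i j]; rewrite !inE /=; apply/negP => /andP[/andP[_ ji]].
  case/imsetP => -[k l]; rewrite !inE /= => /andP[_ lk] [ei ej].
  by move: ji; rewrite ei ej ltnNge ltnW.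
have UUV : U :|: V' = setX A B.
  apply/setP => -[i j]; rewrite !inE /=; apply/orP/andP.
    case=> [/andP[/andP[] //]|/imsetP[[k l]]].
    by rewrite !inE /= => /andP[/andP[kB lA] _] [-> ->].
  case=> iA jB; have [ji|ij|eij] := ltngtP j i; first by left; rewrite iA jB.
    right; apply/imsetP; exists (j, i) => //.
    by rewrite !inE /= iA jB.
  have := disjointFr dAB iA; rewrite -(_ : j = i) ?jB //; exact: val_inj.
have := cardsUI U V'; rewrite UV UUV cards0 addn0 cardsX => E.
by move: (congr1 odd E); rewrite oddM (negbTE eA) /= oddD; case: odd; case: odd.
Qed.

(** Structure constants of the product. With the side condition moved into a coefficient all sums
    are unrestricted and can be exchanged freely. *)
Definition gcoef A B S : R :=
  if (A :|: B == S) && [disjoint A & B] then gsgn A B else 0.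

Lemma gmulE x y S :
  gmul x y S = \sum_A \sum_B gcoef A B S * (x A * y B).
Proof.
rewrite ffunE; apply: eq_bigr => A _; rewrite big_mkcond; apply: eq_bigr => B _.
by rewrite /gcoef; case: ifP; rewrite ?mul0r ?mulrA.
Qed.

(** Only D = A ∪ B contributes on the left and D = B ∪ C on the right. Both terms vanish unless A,
    B, C are pairwise disjoint with union S, and then multiplicativity of the sign in each argument
    makes them equal. *)
Lemma gcoefA A B C S :
  \sum_D gcoef A B D * gcoef D C S = \sum_D gcoef B C D * gcoef A D S.
Proof.
rewrite (bigD1 (A :|: B)) //= big1 ?addr0; last first.
  by move=> D nD; rewrite /gcoef eq_sym (negbTE nD) mul0r.
rewrite [RHS](bigD1 (B :|: C)) //= big1 ?addr0; last first.
  by move=> D nD; rewrite /gcoef eq_sym (negbTE nD) mul0r.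
rewrite /gcoef !eqxx /= setUA.
have [eS|nS] := eqVneq (A :|: B :|: C) S; last by rewrite /= !mulr0.
rewrite /= !disjoints_subset subUset setCU subsetI -!disjoints_subset.
have [dAB|_] := boolP [disjoint A & B]; rewrite /= ?mul0r ?mulr0;
  have [dBC|_] := boolP [disjoint B & C]; rewrite /= ?andbF ?andbT ?mul0r ?mulr0 //.
have [dAC|_] := boolP [disjoint A & C]; rewrite /= ?mulr0 //.
by rewrite gsgnUl // gsgnUr //; ring.
Qed.

Lemma gmulA x y z : gmul x (gmul y z) = gmul (gmul x y) z.
Proof.
apply/ffunP => S; rewrite !gmulE.
transitivity (\sum_A \sum_B \sum_C (\sum_D gcoef B C D * gcoef A D S) * (x A * y B * z C)).
  apply: eq_bigr => A _; under eq_bigr => D _.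
    rewrite gmulE mulrA mulr_sumr.
    under eq_bigr => B _ do rewrite mulr_sumr.
  over.
  rewrite exchange_big /=; apply: eq_bigr => B _.
  rewrite exchange_big /=; apply: eq_bigr => C _.
  by rewrite mulr_suml; apply: eq_bigr => D _; ring.
under eq_bigr => A _ do under eq_bigr => B _ do under eq_bigr => C _ do rewrite -gcoefA.
transitivity (\sum_D \sum_A \sum_B \sum_C
    gcoef A B D * gcoef D C S * (x A * y B * z C)).
  symmetry; rewrite exchange_big /=; apply: eq_bigr => A _.
  rewrite exchange_big /=; apply: eq_bigr => B _.
  rewrite exchange_big; apply: eq_bigr => C _ /=.
  by rewrite mulr_suml.
apply: eq_bigr => D _; symmetry.
under eq_bigr => C _.
  rewrite gmulE mulr_suml mulr_sumr.
  under eq_bigr => A _ do rewrite mulr_suml mulr_sumr.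
over.
rewrite exchange_big; apply: eq_bigr => A _ /=.
rewrite exchange_big; apply: eq_bigr => B _ /=.
by apply: eq_bigr => C _; ring.
Qed.

Lemma gcoefC A B S : ~~ odd #|A| -> gcoef A B S = gcoef B A S.
Proof.
move=> eA; rewrite /gcoef setUC disjoint_sym; case: ifP => // /andP[_ dAB].
by rewrite gsgnC // disjoint_sym.
Qed.

Lemma gmulC x y : geven x -> gmul x y = gmul y x.
Proof.
move=> ex; apply/ffunP => S; rewrite !gmulE exchange_big /=.
apply: eq_bigr => B _; apply: eq_bigr => A _.
have [oA|eA] := boolP (odd #|A|); first by rewrite ex // mul0r !mulr0.
by rewrite gcoefC // [x A * _]mulrC.
Qed.

Lemma gmulDl x y z : gmul (gadd x y) z = gadd (gmul x z) (gmul y z).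
Proof.
apply/ffunP => S; rewrite [RHS]ffunE !gmulE -big_split; apply: eq_bigr => A _ /=.
by rewrite -big_split; apply: eq_bigr => B _ /=; rewrite [gadd _ _ _]ffunE; ring.
Qed.

Lemma gcoef0 B S : gcoef set0 B S = (B == S)%:R.
Proof.
rewrite /gcoef set0U disjoints_subset sub0set andbT; case: eqP => // _.
by rewrite /gsgn (_ : [set _ | _] = set0) ?cards0 //; apply/setP => p; rewrite !inE.
Qed.

Lemma gmul_const c x : gmul (gconst N c) x = gscale c x.
Proof.
apply/ffunP => S; rewrite gmulE [RHS]ffunE (bigD1 set0) //= [X in _ + X]big1 ?addr0.
  rewrite (bigD1 S) //= gcoef0 eqxx big1 ?addr0 => [|B nB].
    by rewrite ffunE eqxx mul1r.
  by rewrite gcoef0 (negbTE nB) mul0r.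
by move=> A nA; rewrite big1 // => B _; rewrite ffunE (negbTE nA) mul0r mulr0.
Qed.

Lemma gcoef_supp A B S : gcoef A B S != 0 -> #|S| = (#|A| + #|B|)%N.
Proof.
rewrite /gcoef; case: ifP => [/andP[/eqP <- dAB] _|_]; last by rewrite eqxx.
by rewrite cardsU (disjoint_setI0 dAB) cards0 subn0.
Qed.

Lemma gmul_supp x y S : gmul x y S != 0 ->
  exists A B, [/\ #|S| = (#|A| + #|B|)%N, x A != 0 & y B != 0].
Proof.
rewrite gmulE => nz.
have [A /existsP[B /and3P[cS xA yB]]|nex] :=
  pickP (fun A => [exists B, [&& gcoef A B S != 0, x A != 0 & y B != 0]]).
  by exists A, B; split=> //; apply: gcoef_supp.
case/eqP: nz; rewrite big1 // => A _; rewrite big1 // => B _; apply/eqP.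
move/negbT: (nex A); rewrite negb_exists => /forallP/(_ B).
by rewrite !negb_and !negbK => /or3P[]/eqP->; rewrite ?mul0r ?mulr0.
Qed.

Lemma geven_mul x y : geven x -> geven y -> geven (gmul x y).
Proof.
move=> ex ey S oS; apply/eqP/negPn/negP => /gmul_supp[A [B [cS xA yB]]].
move: oS; rewrite cS oddD; have [oA|eA] := boolP (odd #|A|).
  by rewrite ex ?eqxx in xA.
by case: (boolP (odd #|B|)) => // oB; rewrite ey ?eqxx in yB.
Qed.

Lemma geven_mul_odd x y : godd x -> godd y -> geven (gmul x y).
Proof.
move=> ex ey S oS; apply/eqP/negPn/negP => /gmul_supp[A [B [cS xA yB]]].
move: oS; rewrite cS oddD; have [oA|eA] := boolP (odd #|A|); last first.
  by rewrite ex ?eqxx in xA.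
by case: (boolP (odd #|B|)) => // oB; rewrite ey ?eqxx in yB.
Qed.

Lemma gbody_mul x y : gbody (gmul x y) = gbody x * gbody y.
Proof.
rewrite /gbody gmulE (bigD1 set0) //= (bigD1 set0) //= gcoef0 eqxx mul1r.
rewrite big1 ?addr0 => [|B nB]; last by rewrite gcoef0 (negbTE nB) mul0r.
rewrite big1 ?addr0 // => A nA; rewrite big1 // => B _.
rewrite /gcoef; case: ifP => [/andP[/eqP e _]|_]; last by rewrite mul0r.
by move/setP: e => e; case/eqP: nA; apply/setP=> i; have := e i; rewrite !inE; case: (i \in A).
Qed.

Lemma geven_const c : geven (gconst N c).
Proof. by move=> S; rewrite ffunE; case: eqP => // ->; rewrite cards0. Qed.

Lemma geven_add x y : geven x -> geven y -> geven (gadd x y).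
Proof. by move=> ex ey S oS; rewrite ffunE ex ?ey ?addr0. Qed.

Lemma geven_opp x : geven x -> geven (gopp x).
Proof. by move=> ex S oS; rewrite ffunE ex ?oppr0. Qed.

(** A subtype cut out by a boolean predicate has irrelevant membership proofs, so equality of even
    elements reduces to equality in [grass N]. *)
Definition gevenb x := [forall S : {set 'I_N}, odd #|S| ==> (x S == 0)].

Lemma gevenP x : reflect (geven x) (gevenb x).
Proof.
apply: (iffP forallP) => [ex S oS|ex S]; last by apply/implyP => /ex->.
by apply/eqP; apply: (implyP (ex S)).
Qed.

End GrassmannProduct.

(** * The even elements as a commutative ring, with constants and body as ring morphisms *)

HB.instance Definition _ (N : nat) :=
  Choice.copy (grass N) {ffun {set 'I_N} -> R}.

Record evgr (N : nat) := EvGr { evval :> grass N; _ : gevenb evval }.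
HB.instance Definition _ N := [isSub for @evval N].
HB.instance Definition _ N := [Choice of evgr N by <:].

Section EvenRing.
Variable N : nat.
Implicit Types x y z : evgr N.

Lemma evvalP x : geven x.
Proof. exact/gevenP/(valP x). Qed.

Definition mkev (x : grass N) (ex : geven x) : evgr N := EvGr (introT (gevenP x) ex).
Definition ev_add x y := mkev (geven_add (evvalP x) (evvalP y)).
Definition ev_opp x := mkev (geven_opp (evvalP x)).
Definition ev_mul x y := mkev (geven_mul (evvalP x) (evvalP y)).
Definition ev_const (c : R) := mkev (@geven_const N c).

Fact ev_addA : associative ev_add.
Proof. by move=> x y z; apply/val_inj/ffunP => S; rewrite !ffunE addrA. Qed.
Fact ev_addC : commutative ev_add.
Proof. by move=> x y; apply/val_inj/ffunP => S; rewrite !ffunE addrC. Qed.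
Fact ev_add0 : left_id (ev_const 0) ev_add.
Proof. by move=> x; apply/val_inj/ffunP => S; rewrite !ffunE if_same add0r. Qed.
Fact ev_addN : left_inverse (ev_const 0) ev_opp ev_add.
Proof. by move=> x; apply/val_inj/ffunP => S; rewrite !ffunE if_same addNr. Qed.
HB.instance Definition _ := GRing.isZmodule.Build (evgr N) ev_addA ev_addC ev_add0 ev_addN.

Fact ev_mulA : associative ev_mul.
Proof. by move=> x y z; apply/val_inj/gmulA. Qed.
Fact ev_mulC : commutative ev_mul.
Proof. by move=> x y; apply/val_inj/gmulC/evvalP. Qed.
Fact ev_mul1 : left_id (ev_const 1) ev_mul.
Proof.
move=> x; apply/val_inj; rewrite /= gmul_const.
by apply/ffunP => S; rewrite ffunE mul1r.
Qed.
Fact ev_mulDl : left_distributive ev_mul ev_add.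
Proof. by move=> x y z; apply/val_inj/gmulDl. Qed.
Fact ev_1neq0 : ev_const 1 != ev_const 0.
Proof.
apply/eqP => /(congr1 (fun x : evgr N => evval x set0)) /eqP.
by rewrite !ffunE eqxx oner_eq0.
Qed.
HB.instance Definition _ := GRing.Zmodule_isComNzRing.Build (evgr N)
  ev_mulA ev_mulC ev_mul1 ev_mulDl ev_1neq0.

Lemma evD x y : evval (x + y) = gadd x y. Proof. by []. Qed.
Lemma evN x : evval (- x) = gopp x. Proof. by []. Qed.
Lemma evM x y : evval (x * y) = gmul x y. Proof. by []. Qed.
Lemma ev_coefD x y S : evval (x + y) S = evval x S + evval y S. Proof. by rewrite evD ffunE. Qed.
Lemma ev_coefN x S : evval (- x) S = - evval x S. Proof. by rewrite evN ffunE. Qed.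

Fact ev_const_zmod : zmod_morphism ev_const.
Proof.
by move=> c d; apply/val_inj/ffunP => S; rewrite !ffunE; case: ifP; rewrite ?subr0.
Qed.
Fact ev_const_monoid : monoid_morphism ev_const.
Proof.
split=> // c d; apply/val_inj; rewrite /= gmul_const.
by apply/ffunP => S; rewrite !ffunE; case: ifP; rewrite ?mulr0.
Qed.
HB.instance Definition _ := GRing.isZmodMorphism.Build R (evgr N) ev_const ev_const_zmod.
HB.instance Definition _ := GRing.isMonoidMorphism.Build R (evgr N) ev_const ev_const_monoid.

Definition body x : R := gbody x.
Fact body_zmod : zmod_morphism body.
Proof. by move=> x y; rewrite /body /gbody ev_coefD ev_coefN. Qed.
Fact body_monoid : monoid_morphism body.
Proof. by split=> [|x y]; rewrite /body ?gbody_mul // /gbody ffunE eqxx. Qed.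
HB.instance Definition _ := GRing.isZmodMorphism.Build (evgr N) R body body_zmod.
HB.instance Definition _ := GRing.isMonoidMorphism.Build (evgr N) R body body_monoid.

Lemma body_const c : body (ev_const c) = c.
Proof. by rewrite /body /gbody ffunE eqxx. Qed.

End EvenRing.

(** * Inverses, square roots and weighted norms *)

Section TaylorExpansions.
Variable N : nat.
Implicit Types x y z : evgr N.

Definition soul x : evgr N := x - ev_const N (body x).

Lemma body_soul x : body (soul x) = 0.
Proof. by rewrite /soul rmorphB /= body_const subrr. Qed.

Lemma evval_soul x : gsoul (evval x) = evval (soul x).
Proof.
apply/ffunP => S; rewrite ev_coefD ev_coefN !ffunE.
by case: ifP; rewrite ?oppr0.
Qed.

Lemma evval_exp x k : gpow (evval x) k = evval (x ^+ k).
Proof. by elim: k => // k IH; rewrite exprS evM -IH. Qed.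

Lemma evval_scale c x : gscale c (evval x) = evval (ev_const N c * x).
Proof. by rewrite evM gmul_const. Qed.

Lemma evval_sum (I : Type) (r : seq I) (F : I -> evgr N) :
  \big[@gadd N/gconst N 0]_(i <- r) evval (F i) = evval (\sum_(i <- r) F i).
Proof. by elim/big_rec2: _ => [|i y1 y2 _ ->]. Qed.

Lemma evval_taylor c x :
  taylor c (evval x) = evval (\sum_(k < N.+1) ev_const N (c k) * soul x ^+ k).
Proof.
rewrite -evval_sum; apply: eq_bigr => k _.
by rewrite evval_soul evval_exp evval_scale.
Qed.

(** Each factor without body contributes at least one generator, so x^k is supported on sets of at
    least k elements. *)
Lemma exp_body0 x : body x = 0 -> x ^+ N.+1 = 0.
Proof.
move=> bx; have supp k : forall S : {set 'I_N}, evval (x ^+ k) S != 0 -> (k <= #|S|)%N.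
  elim: k => // k IH S; rewrite exprS evM => /gmul_supp[A [B [-> xA /IH]]].
  rewrite -add1n; apply: leq_add; rewrite card_gt0; apply: contraNneq xA => ->.
  exact/eqP.
apply/val_inj/ffunP => S; rewrite [RHS]ffunE if_same; apply/eqP/negPn/negP.
by move/supp; rewrite ltnNge -[X in (_ <= X)%N]card_ord max_card.
Qed.

Lemma body_X_soul x c k : body (ev_const N c * soul x ^+ k) = (if k == 0%N then c else 0).
Proof. by rewrite rmorphM rmorphXn /= body_const body_soul expr0n; case: eqP; rewrite ?mulr1 ?mulr0. Qed.

Lemma body_taylor (c : nat -> R) x :
  body (\sum_(k < N.+1) ev_const N (c k) * soul x ^+ k) = c 0%N.
Proof.
rewrite rmorph_sum big_ord_recl /= body_X_soul big1 ?addr0 // => k _.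
by rewrite body_X_soul.
Qed.

Definition ev_ginv x : evgr N :=
  \sum_(k < N.+1) ev_const N ((-1) ^+ k / body x ^+ k.+1) * soul x ^+ k.

(** With z = - soul x / body x one has x = body x (1 - z), and the Taylor polynomial is a geometric
    sum in z divided by body x; it is complete because z^(N+1) = 0. *)
Lemma ev_ginvP x : body x != 0 -> ev_ginv x * x = 1.
Proof.
move=> bx; pose u := ev_const N (body x)^-1; pose z := - (u * soul x).
have ub : ev_const N (body x) * u = 1 by rewrite /u -(rmorphM (ev_const N)) divff // rmorph1.
have -> : ev_ginv x = u * \sum_(k < N.+1) z ^+ k.
  rewrite mulr_sumr; apply: eq_bigr => k _.
  rewrite /z -mulNr exprMn mulrA; congr (_ * _).
  rewrite /u -(rmorphN (ev_const N)) -(rmorphXn (ev_const N)) -(rmorphM (ev_const N)) ; congr (ev_const N _); rewrite exprSr invfM (exprNn (body x)^-1) exprVn; ring.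
have -> : x = ev_const N (body x) * (1 - z).
  by rewrite mulrDr mulr1 /z opprK mulrA ub mul1r /soul addrC subrK.
rewrite mulrACA [u * _]mulrC ub mul1r mulrC -opprB mulNr -subrX1 exp_body0 ?sub0r ?opprK //.
by rewrite rmorphN rmorphM /= body_soul mulr0 oppr0.
Qed.

Definition ev_unit : pred (evgr N) := [pred x | body x != 0].
(** The value x at non-units is the convention of the unit ring interface. *)
Definition ev_inv x := if body x != 0 then ev_ginv x else x.

Fact ev_mulV : {in ev_unit, left_inverse 1 ev_inv *%R}.
Proof. by move=> x bx; rewrite /ev_inv (bx : body x != 0) ev_ginvP. Qed.
Fact ev_unitPl x y : y * x = 1 -> ev_unit x.
Proof.
move/(congr1 (@body N)); rewrite rmorphM rmorph1 => e; apply/eqP => bx.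
by move/eqP: e; rewrite /= bx mulr0 eq_sym oner_eq0.
Qed.
Fact ev_inv_out : {in [predC ev_unit], ev_inv =1 id}.
Proof. by move=> x /negbTE bx; rewrite /ev_inv (bx : (body x != 0) = false). Qed.
HB.instance Definition _ :=
  GRing.ComNzRing_hasMulInverse.Build (evgr N) ev_mulV ev_unitPl ev_inv_out.

Lemma unit_body x : (x \is a GRing.unit) = (body x != 0). Proof. by []. Qed.

Lemma body_inv x : body x != 0 -> body x^-1 = (body x)^-1.
Proof.
move=> bx; apply: (mulfI bx); rewrite divff //.
by rewrite -(rmorphM (@body N)) divrr ?rmorph1.
Qed.

Lemma evval_inv x : body x != 0 -> ginv (evval x) = evval x^-1.
Proof.
by move=> bx; rewrite [x^-1]/(ev_inv x) /ev_inv bx /ginv evval_taylor.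
Qed.

Lemma binom_half0 : binom_half 0 = 1.
Proof. by rewrite /binom_half RdivE big_ord0 fact0 divr1. Qed.

Lemma binom_halfS k :
  k.+1%:R * binom_half k.+1 = (1 / 2 - k%:R) * binom_half k.
Proof.
rewrite /binom_half !RdivE big_ord_recr /= factS natrM invfM.
have n0 : k.+1%:R != 0 :> R by rewrite pnatr_eq0.
move: (\prod_(_ < _) _) (k.+1%:R) n0 (k`!%:R^-1) (1 / 2 - _) => P a a0 f d.
by rewrite -[RHS]mul1r -(divff a0); ring.
Qed.

(* The convolution square [e] of the coefficients satisfies
   [(k + 1) e (k + 1) = (1 - k) e k], the recursion of the series [1 + X]. *)
Lemma binom_half_conv k :
  \sum_(i < k.+1) binom_half i * binom_half (k - i) = (k <= 1)%:R.
Proof.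
pose e n := \sum_(i < n.+1) binom_half i * binom_half (n - i).
pose f n := \sum_(i < n.+1) i%:R * (binom_half i * binom_half (n - i)).
have fE n : f n + f n = n%:R * e n.
  rewrite {2}/f (reindex_inj rev_ord_inj) /= /f /e mulr_sumr -big_split.
  apply: eq_bigr => i _ /=; have le_in : (i <= n)%N by rewrite -ltnS.
  rewrite subSS subKn // [binom_half (n - i) * _]mulrC -mulrDl natrB //.
  by rewrite addrC subrK.
have fS n : f n.+1 = e n / 2 - f n.
  rewrite /f big_ord_recl /= mul0r add0r /e mulr_suml -sumrB.
  apply: eq_bigr => i _; rewrite /bump /= add1n subSS mulrA binom_halfS.
  by move: (binom_half i) (binom_half (n - i)) => u v; field.
have eS n : n.+1%:R * e n.+1 = (1 - n%:R) * e n.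
  rewrite -fE fS mulrBl mul1r -fE.
  by move: (e n) (f n) => u v; field.
have e0 : e 0%N = 1 by rewrite /e big_ord1 binom_half0 mulr1.
rewrite -/(e k); case: k => [|k]; first exact: e0.
have n0 n : n.+1%:R != 0 :> R by rewrite pnatr_eq0.
elim: k => [|k IH]; first by have := eS 0%N; rewrite e0 mul1r subr0 mulr1.
apply: (mulfI (n0 k.+1)); rewrite eS IH; case: k {IH} => [|k]; first by rewrite subrr mul0r mulr0.
by rewrite !mulr0.
Qed.

Definition ev_sqrt x : evgr N :=
  \sum_(k < N.+1) ev_const N (sqrt (body x) * binom_half k / body x ^+ k) * soul x ^+ k.

Lemma evval_sqrt x : gsqrt (evval x) = evval (ev_sqrt x).
Proof. by rewrite /gsqrt evval_taylor. Qed.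

Lemma body_sqrt x : body (ev_sqrt x) = sqrt (body x).
Proof. by rewrite (body_taylor (fun k => sqrt (body x) * binom_half k / body x ^+ k)) binom_half0 expr0 divr1 mulr1. Qed.

(** Evaluating a real polynomial at the nilpotent z = soul x / body x involves only its coefficients
    up to degree N. Up to that degree the truncated binomial series squares to 1 + X, by
    [binom_half_conv], and x = body x (1 + z). *)
Lemma ev_sqrtP x : 0 < body x -> ev_sqrt x * ev_sqrt x = x.
Proof.
move=> bx; pose u := ev_const N (body x)^-1; pose z := u * soul x.
pose c := ev_const N (sqrt (body x)).
have bx0 : body x != 0 by rewrite gt_eqF.
have ub : ev_const N (body x) * u = 1 by rewrite /u -(rmorphM (ev_const N)) divff // rmorph1.
have zN : z ^+ N.+1 = 0 by rewrite exp_body0 // rmorphM /= body_soul mulr0.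
pose p := \poly_(k < N.+1) binom_half k.
pose phi (q : {poly R}) : evgr N := (map_poly (ev_const N) q).[z].
have phiM q r : phi (q * r) = phi q * phi r by rewrite /phi rmorphM hornerM.
have phi_take q : phi q = phi (take_poly N.+1 q).
  rewrite -{1}(poly_take_drop N.+1 q) /phi rmorphD hornerD /=.
  by rewrite rmorphM /= map_polyXn hornerM hornerXn zN mulr0 addr0.
have -> : ev_sqrt x = c * phi p.
  rewrite /phi (@horner_coef_wide _ N.+1); last by rewrite size_map_poly size_poly.
  rewrite mulr_sumr; apply: eq_bigr => k _.
  rewrite coef_map coef_poly ltn_ord /z exprMn; move: (binom_half k) => bk; rewrite !mulrA.
  by rewrite /c /u -(rmorphXn (ev_const N)) -!(rmorphM (ev_const N)) exprVn.
have cc : c * c = ev_const N (body x).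
  rewrite /c -(rmorphM (ev_const N)); congr (ev_const N _); apply: sqrt_def; apply/RleP/ltW/bx.
rewrite (mulrACA c) cc -phiM phi_take.
have -> : take_poly N.+1 (p * p) = take_poly N.+1 (1 + 'X).
  apply/polyP => i; rewrite !coef_take_poly; case: ltnP => // iN.
  rewrite coefM coefD coef1 coefX -(_ : (i <= 1)%:R = (i == 0%N)%:R + (i == 1%N)%:R :> R); last first.
    by case: i {iN} => [|[|i]]; rewrite ?addr0 ?add0r.
  rewrite -binom_half_conv; apply: eq_bigr => j _; rewrite !coef_poly.
  by rewrite (leq_trans (ltn_ord j)) // (leq_ltn_trans (leq_subr _ _)).
rewrite -phi_take /phi rmorphD /= rmorph1 map_polyX hornerD hornerC hornerX.
by rewrite mulrDr mulr1 mulrA ub mul1r /soul addrC subrK.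
Qed.

End TaylorExpansions.

(** * Weighted norms *)

Section WeightedNorm.
Variable N : nat.
Implicit Types x y z : evgr N.

Definition wnorm (t : R) x : R := \sum_(S : {set 'I_N}) t ^+ #|S| * `|evval x S|.

Lemma wnorm1 x : wnorm 1 x = grnorm (evval x).
Proof. by apply: eq_bigr => S _; rewrite expr1n mul1r. Qed.

Lemma wnorm_ge0 t x : 0 <= t -> 0 <= wnorm t x.
Proof. by move=> t0; apply: sumr_ge0 => S _; rewrite mulr_ge0 ?exprn_ge0. Qed.

Lemma wnormD t x y : 0 <= t -> wnorm t (x + y) <= wnorm t x + wnorm t y.
Proof.
move=> t0; rewrite /wnorm -big_split; apply: ler_sum => S _ /=.
by rewrite -mulrDr ler_wpM2l ?exprn_ge0 // ev_coefD ler_normD.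
Qed.

Lemma wnormN t x : wnorm t (- x) = wnorm t x.
Proof. by apply: eq_bigr => S _; rewrite ev_coefN normrN. Qed.

Lemma wnormB t x y : 0 <= t -> wnorm t (x - y) <= wnorm t x + wnorm t y.
Proof. by move=> t0; rewrite -(wnormN t y) wnormD. Qed.

Lemma wnorm_const t c : wnorm t (ev_const N c) = `|c|.
Proof.
rewrite /wnorm (bigD1 set0) //= ffunE eqxx cards0 expr0 mul1r big1 ?addr0 //.
by move=> S nS; rewrite ffunE (negbTE nS) normr0 mulr0.
Qed.

Lemma wnorm_sum t (I : Type) (r : seq I) (F : I -> evgr N) : 0 <= t ->
  wnorm t (\sum_(i <- r) F i) <= \sum_(i <- r) wnorm t (F i).
Proof.
move=> t0; elim/big_rec2: _ => [|i a b _ IH].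
  by rewrite (wnorm_const t 0 : wnorm t 0 = _) normr0.
by apply: le_trans (wnormD _ _ t0) _; rewrite lerD2l.
Qed.

(** Only disjoint A, B contribute to the product, and for these t^|A ∪ B| = t^|A| t^|B|. *)
Lemma wnormM t x y : 0 <= t -> wnorm t (x * y) <= wnorm t x * wnorm t y.
Proof.
move=> t0; rewrite /wnorm mulr_suml.
pose F (A B : {set 'I_N}) := t ^+ #|A| * `|evval x A| * (t ^+ #|B| * `|evval y B|).
apply: (@le_trans _ _ (\sum_(S : {set 'I_N}) \sum_A \sum_B (if (A :|: B == S) then F A B else 0))).
  apply: ler_sum => S _; rewrite evM gmulE.
  apply: le_trans (ler_wpM2l (exprn_ge0 _ t0) (ler_norm_sum _ _ _)) _.
  rewrite mulr_sumr; apply: ler_sum => A _.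
  apply: le_trans (ler_wpM2l (exprn_ge0 _ t0) (ler_norm_sum _ _ _)) _.
  rewrite mulr_sumr; apply: ler_sum => B _.
  have F0 : 0 <= F A B by rewrite !mulr_ge0 ?exprn_ge0.
  have [->|/[dup] /gcoef_supp cS] := eqVneq (gcoef A B S) 0.
    by rewrite mul0r normr0 mulr0; case: ifP.
  rewrite /gcoef; case: ifP => [/andP[-> dAB] _|]; last by rewrite eqxx.
  rewrite cS exprD !normrM /gsgn normrX normrN1 expr1n mul1r.
  by rewrite mulrACA lexx.
rewrite exchange_big; apply: ler_sum => A _ /=.
rewrite exchange_big mulr_sumr; apply: ler_sum => B _ /=.
by rewrite -big_mkcond (big_pred1 (A :|: B)) // => S; rewrite eq_sym.
Qed.

Lemma wnorm_body t x : 0 <= t -> `|body x| <= wnorm t x.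
Proof.
move=> t0; rewrite /wnorm (bigD1 set0) //= cards0 expr0 mul1r lerDl.
by apply: sumr_ge0 => S _; rewrite mulr_ge0 ?exprn_ge0.
Qed.

Lemma ler_wnorm t t' x : 0 <= t <= t' -> wnorm t x <= wnorm t' x.
Proof.
case/andP=> t0 tt'; apply: ler_sum => S _; rewrite ler_wpM2r // lerXn2r //.
by rewrite nnegrE (le_trans t0).
Qed.

Lemma wnorm_small t x : 0 <= t <= 1 -> wnorm t x <= `|body x| + t * grnorm (evval x).
Proof.
case/andP=> t0 t1; rewrite /wnorm (bigD1 set0) //= cards0 expr0 mul1r lerD2l.
rewrite /grnorm mulr_sumr [leRHS](bigD1 set0) //= -[leLHS]add0r.
apply: lerD; first by rewrite mulr_ge0.
apply: ler_sum => S nS; rewrite ler_wpM2r //.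
rewrite -[leRHS]mulr1 -(prednK (_ : 0 < #|S|)%N) ?card_gt0 // exprS ler_wpM2l //.
by rewrite exprn_ile1.
Qed.

Lemma grnorm_wnorm t x : 0 < t <= 1 -> grnorm (evval x) <= t ^- N * wnorm t x.
Proof.
case/andP=> t0 t1; rewrite mulrC ler_pdivlMr ?exprn_gt0 // mulrC mulr_sumr.
apply: ler_sum => S _; rewrite ler_wpM2r //.
apply: ler_wiXn2l => //; first exact: ltW.
by rewrite -[X in (_ <= X)%N]card_ord max_card.
Qed.

(** For fixed x the norm is a polynomial in the weight with value |body x| at 0. This supplies the
    continuity argument for [atom_le]. *)
Lemma wnorm_ivt t m x : 0 <= t -> `|body x| <= m <= wnorm t x ->
  exists2 t', 0 <= t' <= t & wnorm t' x = m.
Proof.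
move=> t0 mx; pose p : {poly R} := \sum_(S : {set 'I_N}) `|evval x S| *: 'X^#|S| - m%:P.
have pE a : p.[a] = wnorm a x - m.
  rewrite /p hornerD hornerN hornerC horner_sum; congr (_ - _).
  by apply: eq_bigr => S _; rewrite hornerZ hornerXn mulrC.
have [|t' t'I /rootP] := @poly_ivt _ p 0 t t0.
  rewrite !pE subr_ge0 subr_le0 (_ : wnorm 0 x = `|body x|) //.
  rewrite /wnorm (bigD1 set0) //= cards0 expr0 mul1r big1 ?addr0 // => S nS.
  by rewrite expr0n cards_eq0 (negbTE nS) mul0r.
by rewrite pE => /eqP; rewrite subr_eq0 => /eqP ?; exists t'.
Qed.

End WeightedNorm.

(** * Slopes, flips and the gap function *)

Section Slopes.
Implicit Types u v b c : int * int.

Lemma vdetNr u v : vdet u (- v) = - vdet u v.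
Proof. by rewrite /vdet /=; ring. Qed.
Lemma vdetDr u v w : vdet u (v + w) = vdet u v + vdet u w.
Proof. by rewrite /vdet /=; ring. Qed.
Lemma vdetDl u v w : vdet (v + w) u = vdet v u + vdet w u.
Proof. by rewrite /vdet /=; ring. Qed.
Lemma vdetC u v : vdet v u = - vdet u v.
Proof. by rewrite /vdet /=; ring. Qed.
Lemma vdet_self u : vdet u u = 0.
Proof. by rewrite /vdet /=; ring. Qed.

Lemma nrmE v : nrm v = v \/ nrm v = - v.
Proof. by rewrite /nrm; case: ifP; [right|left]. Qed.

Lemma nrmN v : nrm (- v) = nrm v.
Proof.
case: v => x y; rewrite /nrm /= !oppr_lt0 oppr_eq0 !opprK.
by case: (ltgtP y 0) => [||->] //=; case: (ltgtP x 0) => [||->] //=; rewrite ?oppr0.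
Qed.

Lemma nrm_arc v : arcb v -> nrm v = v.
Proof. by case: v => x y /andP[_]; rewrite /nrm /=; case: ltgtP => //= _ /eqP->. Qed.

Lemma arc_nrm v : gcdz v.1 v.2 == 1 -> arcb (nrm v).
Proof.
case: v => x y /= g; have gx : y = 0 -> `|x|%N = 1%N.
  by move=> y0; move: g; rewrite y0 gcdz0 => /eqP[].
by rewrite /arcb /nrm /=; case: ifP => /= c; rewrite ?gcdNz ?gcdzN g /=; lia.
Qed.

Lemma adjacentC b c : adjacent b c = adjacent c b.
Proof. by rewrite /adjacent vdetC normrN. Qed.

Lemma adjacentNr b c : adjacent b (- c) = adjacent b c.
Proof. by rewrite /adjacent vdetNr normrN. Qed.

Lemma adjacentDr b c : adjacent b (b + c) = adjacent b c.
Proof. by rewrite /adjacent vdetDr vdet_self add0r. Qed.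

Lemma adjacent_prim b c : adjacent b c -> gcdz b.1 b.2 == 1.
Proof.
rewrite /adjacent /vdet => d.
have {}d : absz (b.1 * c.2 - b.2 * c.1)%R = 1%N by lia.
have : (gcdz b.1 b.2 %| b.1 * c.2 - b.2 * c.1)%Z.
  by rewrite rpredB // dvdz_mulr ?dvdz_gcdl ?dvdz_gcdr.
by rewrite dvdzE d dvdn1.
Qed.

Lemma odd_abszD (x y : int) : odd (absz (x + y)%R) = odd `|x|%N (+) odd `|y|%N.
Proof. lia. Qed.
Lemma odd_abszB (x y : int) : odd (absz (x - y)%R) = odd `|x|%N (+) odd `|y|%N.
Proof. lia. Qed.
End Slopes.

(** * Algebra of a single flip, over an arbitrary commutative ring *)

Section FlipAlgebra.
Variable A : comNzRingType.
Variables (a b c d h sb sc sd wb wc wd : A).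
Hypotheses (hb : sb * (b * h) = 1) (hc : sc * (c * h) = 1) (hd : sd * (d * h) = 1).
Hypothesis ptol : a * d = b * b + c * c + b * c * wd.
Hypothesis trace : h * b * c = a + d + wb * c + wc * b.

(** Here b, c are the lengths of two adjacent arcs, a and d those of their difference and sum, and
    sb, sc, sd the inverses of bh, ch, dh. [trace] is the semi-perimeter formula of {b, c, d} times
    bc, with (b^2 + c^2 + bc wd)/d replaced by a through [ptol]; multiplied by h sb sc it gives the
    claim. *)
Lemma flip_psi : 1 - d * h * sb * sc = a * h * sb * sc + wb * sb + wc * sc.
Proof.
apply/eqP; rewrite -subr_eq0; apply/eqP.
transitivity ((h * b * c - (a + d + wb * c + wc * b)) * (h * sb * sc)
  - (sb * (b * h) - 1) * (sc * (c * h)) - (sc * (c * h) - 1)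
  + wb * sb * (sc * (c * h) - 1) + wc * sc * (sb * (b * h) - 1)); first by ring.
by rewrite trace hb hc; ring.
Qed.

Lemma flip_gap : a * h * sb * sc * (d * h * sb * sc) = sb * sb + sc * sc + sb * sc * wd.
Proof.
transitivity ((a * d) * (h * sb * sc) * (h * sb * sc)); first by ring.
rewrite ptol.
transitivity ((sb * (b * h)) * (sb * (b * h)) * sc * sc
  + (sc * (c * h)) * (sc * (c * h)) * sb * sb
  + (sb * (b * h)) * (sc * (c * h)) * (sb * sc * wd)); first by ring.
by rewrite hb hc; ring.
Qed.

Lemma flip_len : sd * (d * h * sb * sc) = sb * sc.
Proof. by rewrite -[RHS]mul1r -hd; ring. Qed.

Lemma flip_side : c * h * sb * sd * (d * h * sb * sc) = sb * sb.
Proof.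
transitivity (sd * (d * h) * (sc * (c * h)) * (sb * sb)); first by ring.
by rewrite hd hc !mul1r.
Qed.

Lemma flip_markov : h * b * c * d = b * b + c * c + d * d + wd * b * c + wc * b * d + wb * c * d.
Proof.
transitivity (a * d + d * d + wb * c * d + wc * b * d); last by rewrite ptol; ring.
by rewrite trace; ring.
Qed.
End FlipAlgebra.

Section Decorated.
Variables (N : nat) (P : STT N).
Implicit Types u v b c : int * int.

Definition theta12 : evgr N := mkev (geven_mul_odd (mu1_odd P) (mu2_odd P)).
Definition Wv v : evgr N :=
  if spin P (odd `|v.1|%N) (odd `|v.2|%N) then theta12 else - theta12.

Fact ev_part_even (x : grass N) :
  geven ([ffun S : {set 'I_N} => if odd #|S| then 0 else x S] : grass N).
Proof. by move=> S oS; rewrite ffunE oS. Qed.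
(** Lengths are known to be even only at arcs. Deleting odd components makes [L] total without
    changing it there, and [nrm] makes it blind to the sign of the vector. *)
Definition ev_part x : evgr N := mkev (@ev_part_even x).
Definition L v : evgr N := ev_part (lam P (nrm v)).

Lemma ev_partE (x : grass N) : geven x -> evval (ev_part x) = x.
Proof.
by move=> ex; apply/ffunP => S; rewrite ffunE; case: ifP => // /ex ->.
Qed.

Lemma evval_L v : arcb v -> evval (L v) = lam P v.
Proof. by move=> av; rewrite /L ev_partE nrm_arc //; apply: lam_even. Qed.

Lemma evval_W v : evval (Wv v) = Wa P v.
Proof. by rewrite /Wa /Wof /Wv; case: ifP. Qed.

Lemma L_nrm v : arcb (nrm v) -> L (nrm v) = L v.
Proof. by move=> av; rewrite /L (nrm_arc av). Qed.

Lemma LN v : L (- v) = L v.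
Proof. by rewrite /L nrmN. Qed.

Lemma WN v : Wv (- v) = Wv v.
Proof. by rewrite /Wv /= !abszN. Qed.

Lemma W_nrm v : Wv (nrm v) = Wv v.
Proof. by case: (nrmE v) => ->; rewrite ?WN. Qed.

Lemma WBD b c : Wv (b - c) = Wv (b + c).
Proof. by rewrite /Wv /= !odd_abszB !odd_abszD. Qed.

Lemma L_pos v : gcdz v.1 v.2 == 1 -> 0 < body (L v).
Proof.
move=> pv; have av := arc_nrm pv.
by rewrite -L_nrm // /body evval_L // lam_pos.
Qed.

Lemma body_W v : body (Wv v) = 0.
Proof.
have w0 : body theta12 = 0.
  by rewrite /body gbody_mul /gbody (mu1_odd P) ?mul0r // cards0.
by rewrite /Wv; case: ifP; rewrite ?rmorphN /= w0 ?oppr0.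
Qed.

Lemma wnorm_W t v : wnorm t (Wv v) = wnorm t theta12.
Proof. by rewrite /Wv; case: ifP; rewrite ?wnormN. Qed.

(** Normalizing b and c changes only signs, which at worst exchanges b + c and b - c up to sign;
    these two have the same class mod 2, hence the same W. *)
Lemma ptolemy_ev b c : adjacent b c ->
  L (b - c) * L (b + c) = L b * L b + L c * L c + L b * L c * Wv (b + c).
Proof.
move=> bc; have pb := adjacent_prim bc.
have pc : gcdz c.1 c.2 == 1 by rewrite adjacentC in bc; apply: adjacent_prim bc.
have key u v : arcb u -> arcb v -> adjacent u v ->
    L (u - v) * L (u + v) = L u * L u + L v * L v + L u * L v * Wv (u + v).
  move=> au av uv; rewrite mulrC; apply/val_inj.
  have uvD : adjacent u (u + v) by rewrite adjacentDr.
  have uvB : adjacent u (u - v) by rewrite adjacentDr adjacentNr.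
  have aD : arcb (nrm (u + v)).
    by apply: arc_nrm; rewrite adjacentC in uvD; apply: adjacent_prim uvD.
  have aB : arcb (nrm (u - v)).
    by apply: arc_nrm; rewrite adjacentC in uvB; apply: adjacent_prim uvB.
  have := ptolemy P au av uv.
  rewrite -[vadd u v]/(u + v) -[vsub u v]/(u - v) -[Wof _ _ _ _]/(Wa P (nrm (u + v))).
  by rewrite -evval_W W_nrm -!evval_L // -!evM -!evD !L_nrm.
have := @key (nrm b) (nrm c) (arc_nrm pb) (arc_nrm pc).
rewrite !L_nrm ?arc_nrm //.
case: (nrmE b) => ->; case: (nrmE c) => ->; rewrite ?opprK.
- exact.
- by rewrite adjacentNr WBD => /(_ bc) <-; rewrite mulrC.
- rewrite adjacentC adjacentNr adjacentC => /(_ bc); rewrite -opprD LN.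
  by rewrite [- b + c]addrC WBD -(LN (c - b)) opprB [c + b]addrC => <-; rewrite mulrC.
- rewrite adjacentNr adjacentC adjacentNr adjacentC => /(_ bc).
  by rewrite -!opprD !LN WN [- b + c]addrC -(LN (c - b)) opprB.
Qed.

Variable h : evgr N.
Hypothesis h_pos : 0 < body h.

Definition slen v := (L v * h)^-1.
Definition xarc v := L v * h - Wv v.
Definition rarc v := ev_const N (1 / 2) * (xarc v + ev_sqrt (xarc v * xarc v - ev_const N 4)).
Definition atom v := slen v * (rarc v)^-1.
Definition alpha v := atom v + Wv v * slen v * ev_const N (1 / 2).
Definition psi b c := 1 - L (b + c) * h * slen b * slen c.
(** No W occurs, because the halves W/2 in Φ(b,c) cancel those in [alpha b] and [alpha c]. *)
Definition gap b c := L (b - c) * h * slen b * slen c - atom b - atom c.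

(** The equation says that h is the super semi-perimeter of {b, c, b+c}. In this form it is
    symmetric under c -> -c, so it says the same of the flipped triangulation {b, c, b-c}. *)
Definition edge b c :=
  adjacent b c /\ h * L b * L c = L (b - c) + L (b + c) + Wv b * L c + Wv c * L b.

Lemma LB b c : L (b - c) = L (c - b).
Proof. by rewrite -LN opprB. Qed.

Lemma edgeC b c : edge b c -> edge c b.
Proof.
case=> bc e; split; first by rewrite adjacentC.
by rewrite LB [c + b]addrC mulrAC e; ring.
Qed.

Lemma edgeNr b c : edge b c -> edge b (- c).
Proof.
case=> bc e; split; first by rewrite adjacentNr.
by rewrite !LN WN opprK e; ring.
Qed.

Lemma edge_prim b c : edge b c ->
  [/\ gcdz b.1 b.2 == 1, gcdz c.1 c.2 == 1 & gcdz (b + c).1 (b + c).2 == 1].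
Proof.
case=> bc _; split; first exact: adjacent_prim bc.
  by rewrite adjacentC in bc; apply: adjacent_prim bc.
by have := bc; rewrite -adjacentDr adjacentC => /adjacent_prim.
Qed.

Lemma body_Lh v : gcdz v.1 v.2 == 1 -> 0 < body (L v * h).
Proof. by move=> pv; rewrite rmorphM mulr_gt0 // L_pos. Qed.

Lemma slenP v : gcdz v.1 v.2 == 1 -> slen v * (L v * h) = 1.
Proof. by move=> pv; rewrite mulVr // unit_body gt_eqF // body_Lh. Qed.

Lemma unit_L v : gcdz v.1 v.2 == 1 -> L v \is a GRing.unit.
Proof. by move=> pv; rewrite unit_body gt_eqF // L_pos. Qed.

Lemma edge_markov b c : edge b c -> let d := b + c in
  h * L b * L c * L d = L b * L b + L c * L c + L d * L d
    + Wv d * L b * L c + Wv c * L b * L d + Wv b * L c * L d.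
Proof. by case=> bc e d; exact: flip_markov (ptolemy_ev bc) e. Qed.

Lemma markov_edge b c : adjacent b c -> let d := b + c in
  h * L b * L c * L d = L b * L b + L c * L c + L d * L d
    + Wv d * L b * L c + Wv c * L b * L d + Wv b * L c * L d -> edge b c.
Proof.
move=> bc d e; split=> //; rewrite -/d.
have pd : gcdz d.1 d.2 == 1.
  by have := bc; rewrite -adjacentDr adjacentC => /adjacent_prim.
apply: (mulIr (unit_L pd)); rewrite e !mulrDl (ptolemy_ev bc) -/d; ring.
Qed.

(** The Markov form of the equation is symmetric in the three arcs, so it also serves the pair b,
    -(b + c), whose sum is -c. *)
Lemma edgeD b c : edge b c -> edge b (b + c).
Proof.
move=> bc; rewrite -[b + c]opprK; apply: edgeNr; apply: markov_edge.
  by rewrite adjacentNr adjacentDr; case: bc.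
rewrite opprD addNKr -opprD !LN !WN mulrAC (edge_markov bc); ring.
Qed.

Lemma psi_compl b c : 1 - psi b c = L (b + c) * h * slen b * slen c.
Proof. by rewrite /psi subKr. Qed.

Lemma psiC b c : psi b c = psi c b.
Proof. by rewrite /psi [b + c]addrC mulrAC. Qed.

Lemma psiE b c : edge b c ->
  psi b c = L (b - c) * h * slen b * slen c + Wv b * slen b + Wv c * slen c.
Proof.
move=> bc; have [pb pc pd] := edge_prim bc; case: bc => bc e.
exact: flip_psi (slenP pb) (slenP pc) e.
Qed.

Lemma gap_psi b c : edge b c -> L (b - c) * h * slen b * slen c * (1 - psi b c) =
  slen b * slen b + slen c * slen c + slen b * slen c * Wv (b + c).
Proof.
move=> bc; have [pb pc pd] := edge_prim bc; case: bc => bc e.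
rewrite psi_compl.
exact: flip_gap (slenP pb) (slenP pc) (ptolemy_ev bc).
Qed.

Lemma slenD b c : edge b c -> slen (b + c) * (1 - psi b c) = slen b * slen c.
Proof.
move=> bc; have [pb pc pd] := edge_prim bc; rewrite psi_compl.
exact: flip_len (slenP pd).
Qed.

Lemma gap_side b c : edge b c ->
  L c * h * slen b * slen (b + c) * (1 - psi b c) = slen b * slen b.
Proof.
move=> bc; have [pb pc pd] := edge_prim bc; rewrite psi_compl.
exact: flip_side (slenP pc) (slenP pd).
Qed.

Lemma body_slen v : gcdz v.1 v.2 == 1 -> body (slen v) = (body (L v * h))^-1.
Proof. by move=> pv; rewrite body_inv // gt_eqF // body_Lh. Qed.

Lemma slen_pos v : gcdz v.1 v.2 == 1 -> 0 < body (slen v).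
Proof. by move=> pv; rewrite body_slen // invr_gt0 body_Lh. Qed.

Lemma psi_pos b c : edge b c -> 0 < body (1 - psi b c).
Proof.
move=> bc; have [pb pc pd] := edge_prim bc; rewrite psi_compl.
by rewrite !rmorphM /= !mulr_gt0 ?L_pos ?slen_pos.
Qed.

Lemma psi_unit b c : edge b c -> 1 - psi b c \is a GRing.unit.
Proof. by move=> bc; rewrite unit_body gt_eqF // psi_pos. Qed.

Lemma psiD b c : edge b c -> psi b (b + c) =
  slen b * slen b * (1 - psi b c)^-1 + Wv b * slen b + Wv (b + c) * slen (b + c).
Proof.
move=> bc; rewrite (psiE (edgeD bc)) opprD addNKr LN -(gap_side bc).
by rewrite mulrK // psi_unit.
Qed.

Lemma ev_half (x : evgr N) : x * ev_const N (1 / 2) + x * ev_const N (1 / 2) = x.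
Proof.
rewrite -mulrDr -rmorphD /= (_ : 1 / 2 + 1 / 2 = 1 :> R); last by field.
by rewrite rmorph1 mulr1.
Qed.

Lemma gapD b c : edge b c ->
  gap b c = gap b (b + c) + gap (b + c) c + (alpha (b + c) + alpha (b + c)).
Proof.
move=> bc; set d := b + c.
(* Additivity of Φ after cancelling the halves at b and c; the two halves at d add up to a whole
   term. Multiplied by the unit 1 - psi b c, every term becomes a polynomial in [slen b], [slen c]
   and W. *)
have side : L (b - c) * h * slen b * slen c = L (b - d) * h * slen b * slen d
    + L (d - c) * h * slen d * slen c + Wv d * slen d.
  apply: (mulIr (psi_unit bc)); rewrite (gap_psi bc) /d addrK opprD addNKr LN.
  have := gap_side (edgeC bc); rewrite [c + b]addrC psiC => side_c.
  rewrite 2![in RHS]mulrDl (gap_side bc) -[Wv _ * _ * _]mulrA (slenD bc).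
  by rewrite [L b * h * _ * _]mulrAC side_c; ring.
rewrite /gap side /alpha -{1}(ev_half (Wv d * slen d)); ring.
Qed.

Lemma body_markov b c : edge b c -> let x v := body (L v * h) in
  x b * x c * x (b + c) = x b ^+ 2 + x c ^+ 2 + x (b + c) ^+ 2.
Proof.
move=> bc x; have := congr1 (@body N) (edge_markov bc).
rewrite !(rmorphD, rmorphM) /= !body_W !mul0r !addr0 /x !rmorphM /= => e.
transitivity (body h ^+ 2 * (body h * body (L b) * body (L c) * body (L (b + c)))).
  by rewrite expr2; ring.
by rewrite e; ring.
Qed.

(** For bodies the Markov equation reads (x_b - 2) x_c x_(b+c) = (x_c - x_(b+c))^2 + x_b^2. The
    bound makes the radicand in [rarc] positive. *)
Lemma edge_gt2 b c : edge b c -> 2 < body (L b * h).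
Proof.
move=> bc; have [pb pc pd] := edge_prim bc; have := body_markov bc => /=.
have := body_Lh pb; have := body_Lh pc; have := body_Lh pd.
move: (body _) (body _) (body _) => z y x x0 y0 z0 e.
rewrite -subr_gt0 -(pmulr_lgt0 _ (mulr_gt0 x0 y0)).
suff -> : (z - 2) * (x * y) = (x - y) ^+ 2 + z ^+ 2.
  by rewrite ltr_wpDl ?sqr_ge0 // exprn_gt0.
transitivity (z * y * x - 2 * (x * y)); first by ring.
by rewrite e; ring.
Qed.

Section BigArc.
Variable v : int * int.
Hypothesis pv : gcdz v.1 v.2 == 1.
Hypothesis v2 : 2 < body (L v * h).

Lemma body_xarc : body (xarc v) = body (L v * h).
Proof. by rewrite rmorphB /= body_W subr0. Qed.

Lemma body_disc : 0 < body (xarc v * xarc v - ev_const N 4).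
Proof.
rewrite rmorphB rmorphM /= body_const body_xarc subr_gt0.
rewrite (_ : 4 = 2 * 2 :> R); last by ring.
by rewrite ltr_pM.
Qed.

(** [rarc v] is a root of X^2 - xX + 1 with x = [xarc v], and x - [rarc v] is the other root. *)
Lemma rarc_quad : rarc v * (xarc v - rarc v) = 1.
Proof.
have Q := ev_sqrtP body_disc; rewrite /rarc.
set X := xarc v in Q *; set q := ev_sqrt _ in Q *; set c := ev_const N (1 / 2).
have cc : c + c = 1 by rewrite -(mul1r c) /c ev_half.
have c4 : c * c * ev_const N 4 = 1.
  rewrite /c -!(rmorphM (ev_const N)) /= -(rmorph1 (ev_const N)); congr ev_const; lra.
transitivity (c * (X + q) * ((c + c) * X - c * (X + q))); first by rewrite cc; ring.
transitivity (c * c * (X * X - q * q)); first by ring.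
by rewrite Q opprB addrC subrK.
Qed.

Lemma body_rarc : 1 < body (rarc v).
Proof.
rewrite /rarc rmorphM rmorphD /= body_const body_xarc body_sqrt.
have : 0 <= sqrt (body (xarc v * xarc v - ev_const N 4)) by rewrite RsqrtE sqrtr_ge0.
by move: v2; move: (sqrt _) (body _) => q z; lra.
Qed.

Lemma rarc_unit : rarc v \is a GRing.unit.
Proof. by rewrite unit_body gt_eqF // (lt_trans ltr01) // body_rarc. Qed.

(** The equation 1/r = x - r in a form free of square roots: 1 - W s - atom equals s r, since s x =
    1 - W s for s = [slen v]. *)
Lemma atom_quad : atom v * (1 - Wv v * slen v - atom v) = slen v * slen v.
Proof.
have rV : (rarc v)^-1 = xarc v - rarc v.
  by rewrite -[LHS]mulr1 -rarc_quad mulKr // rarc_unit.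
have s1 := slenP pv.
have e : 1 - Wv v * slen v - atom v = slen v * rarc v.
  by rewrite /atom rV -{1}s1 /xarc; ring.
by rewrite e /atom mulrACA mulVr ?mulr1 // rarc_unit.
Qed.

Lemma body_atom : 0 <= body (atom v) <= body (slen v).
Proof.
have s0 := slen_pos pv; have r1 := body_rarc.
have r0 : 0 < body (rarc v) by rewrite (lt_trans ltr01).
rewrite /atom rmorphM /= body_inv ?gt_eqF // divr_ge0 ?ltW //=.
by rewrite ltr_pdivrMr // ltr_pMr.
Qed.
End BigArc.

(** After substituting [gap_psi] and [atom_quad] the squares of [slen b] and [slen c] cancel. Each
    remaining term has a factor attached to b and one attached to c, which is the source of the
    product bound on the gap. *)
Lemma gap_factor b c : edge b c ->
  gap b c * (1 - (psi b c + atom b + atom c)) = slen b * slen c * Wv (b + c)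
  + atom b * (Wv c * slen c) + atom c * (Wv b * slen b) + (atom b * atom c + atom b * atom c).
Proof.
move=> bc; have [pb pc pd] := edge_prim bc.
have qb := atom_quad pb (edge_gt2 bc); have qc := atom_quad pc (edge_gt2 (edgeC bc)).
have gp := gap_psi bc; have := psiE bc; rewrite /gap; move: gp.
move: (psi b c) (L (b - c) * h * slen b * slen c) => f g gp fE.
transitivity (g * (1 - f) - (atom b + atom c) * (g + 1 - f) + (atom b + atom c) * (atom b + atom c)).
  by ring.
rewrite gp fE -qb -qc; ring.
Qed.

(** The definition of psi uses the diagonal b + c and [psiE] uses b - c; equating them gives total
    mass 1. Both b and c are endpoints of both intervals, so their atoms count twice. *)
Lemma gap_total b c : edge b c ->
  1 = gap b c + gap b (- c) + (alpha b + alpha b) + (alpha c + alpha c).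
Proof.
move=> bc; have sN : slen (- c) = slen c by rewrite /slen LN.
have aN : atom (- c) = atom c by rewrite /atom /rarc /xarc sN LN WN.
have := psiE bc; rewrite /gap opprK sN aN {1}/psi => e.
rewrite /alpha.
have hb := ev_half (Wv b * slen b); have hc := ev_half (Wv c * slen c).
transitivity (1 - L (b + c) * h * slen b * slen c + L (b + c) * h * slen b * slen c).
  by rewrite subrK.
by rewrite e -{1}hb -{1}hc; ring.
Qed.

End Decorated.

(** * Decay along the Farey tree *)

(** Writing x = z + x y bounds the quotient z / (1 - y) without estimating an inverse. *)
Lemma wnorm_quot N t (x y z : evgr N) : 0 <= t -> x * (1 - y) = z ->
  wnorm t x * (1 - wnorm t y) <= wnorm t z.
Proof.
move=> t0 e; have xe : x = z + x * y by rewrite -e; ring.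
rewrite mulrBr mulr1 lerBlDr {1}xe.
by apply: le_trans (wnormD _ _ t0) _; rewrite lerD2l wnormM.
Qed.

Fixpoint mediants n (b c : int * int) : seq (int * int) :=
  if n is n'.+1 then (b + c) :: mediants n' b (b + c) ++ mediants n' (b + c) c
  else [::].

Lemma sum_mediantsS (V : nmodType) (f : int * int -> V) n b c :
  \sum_(v <- mediants n.+1 b c) f v = f (b + c) +
    (\sum_(v <- mediants n b (b + c)) f v + \sum_(v <- mediants n (b + c) c) f v).
Proof. by rewrite big_cons big_cat. Qed.

Lemma small_exp (r K eps : R) : 0 < r < 1 -> 0 <= K -> 0 < eps ->
  exists n0, forall n, (n0 <= n)%N -> r ^+ n * K <= eps.
Proof.
case/andP=> r0 r1 K0 e0.
pose y : R := eps / (K + 1).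
have y0 : 0 < y by rewrite divr_gt0 // ltr_wpDl.
have [|n0 H] := pow_lt_1_zero r _ y (elimT RltP y0).
  by rewrite RabsE; apply/RltP; rewrite ger0_norm // ltW.
exists n0 => n /ssrnat.leP /H; rewrite RabsE RpowE => /RltP.
rewrite ger0_norm ?exprn_ge0 ?(ltW r0) // => /ltW H1.
apply: le_trans (ler_wpM2r K0 H1) _.
by rewrite mulrAC ler_pdivrMr ?ltr_wpDl // ler_pM2l // lerDl.
Qed.

Section Decay.
Variables (N : nat) (P : STT N) (h : evgr N) (t e : R).
Hypothesis h_pos : 0 < body h.
Hypotheses (t_pos : 0 < t) (e_pos : 0 < e) (e_half : e < 1 / 2).
Hypothesis theta_small : wnorm t (theta12 P) <= e / 4.
Implicit Types u v b c : int * int.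

Let t_ge0 : 0 <= t. Proof. exact: ltW. Qed.
Local Ltac elra := move: e_pos e_half; lra.
Local Ltac enra := move: e_pos e_half; nra.
Local Notation nm := (wnorm t).
Local Notation s := (slen P h).
Local Notation kap v := (nm (slen P h v)).

(** At a sink the body of psi may equal 1/2, so its bound needs slack above 1/2, whereas the bodies
    of [slen] are strictly below 1/2. The slack e/2 is smaller than the margin e, hence by [kapD]
    the new vertex is shorter by the factor (1/2 - e)/(1/2 - e/2) < 1. *)
Definition contracting b c :=
  [/\ edge P h b c, kap b <= 1 / 2 - e, kap c <= 1 / 2 - e & nm (psi P h b c) <= 1 / 2 + e / 2].

Lemma kap_ge0 v : 0 <= kap v. Proof. exact: wnorm_ge0. Qed.

Lemma contractingC b c : contracting b c -> contracting c b.
Proof. by case=> ebc kb kc pbc; split=> //; [exact: edgeC | rewrite psiC]. Qed.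

Lemma kapD b c : contracting b c -> kap (b + c) * (1 / 2 - e / 2) <= kap b * kap c.
Proof.
case=> ebc _ _ pbc; apply: le_trans (wnormM _ _ t_ge0).
apply: le_trans (wnorm_quot t_ge0 (slenD h_pos ebc)).
rewrite ler_wpM2l ?kap_ge0 //; move: pbc; move: (wnorm _ _) => p; elra.
Qed.

Lemma kapD_lt b c : contracting b c ->
  kap (b + c) * (1 / 2 - e / 2) <= kap b * (1 / 2 - e).
Proof.
move=> bc; apply: le_trans (kapD bc) _; case: bc => _ _ kc _.
by rewrite ler_wpM2l ?kap_ge0.
Qed.

Lemma kapD_le b c : contracting b c -> kap (b + c) <= kap b.
Proof.
move=> bc; have := kapD_lt bc; have := kap_ge0 b; have := kap_ge0 (b + c).
move: (kap b) (kap (b + c)) => x y y0 x0 H.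
have [//|xy] := lerP y x.
have : 0 < (y - x) * (1 / 2 - e / 2) by apply: mulr_gt0; elra.
have : 0 <= x * e by apply: mulr_ge0; elra.
elra.
Qed.

Lemma contracting_child b c : contracting b c -> contracting b (b + c).
Proof.
move=> bc; have kd := kapD_le bc; have [ebc kb kc pbc] := bc.
have kd' := le_trans kd kb; split=> //; first exact: edgeD.
rewrite psiD //; set g := s b * s b * _; set u := Wv P b * s b; set w := Wv P _ * s _.
have gE : g * (1 - psi P h b c) = s b * s b by rewrite /g mulrVK // psi_unit.
have gb : nm g * (1 / 2 - e / 2) <= kap b * kap b.
  apply: le_trans (wnormM _ _ t_ge0); apply: le_trans (wnorm_quot t_ge0 gE).
  rewrite ler_wpM2l ?wnorm_ge0 //; move: pbc; move: (wnorm _ (psi _ _ _ _)) => p; elra.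
have ub : nm u <= e / 4 * kap b.
  by apply: le_trans (wnormM _ _ t_ge0) _; rewrite ler_wpM2r ?kap_ge0 // wnorm_W.
have wb : nm w <= e / 4 * kap (b + c).
  by apply: le_trans (wnormM _ _ t_ge0) _; rewrite ler_wpM2r ?kap_ge0 // wnorm_W.
have H : nm (g + u + w) <= nm g + nm u + nm w.
  by apply: le_trans (wnormD _ _ t_ge0) _; rewrite lerD2r wnormD.
apply: le_trans H _; have := kap_ge0 b; have := wnorm_ge0 g t_ge0.
move: (nm g) (nm u) (nm w) (kap b) (kap (b + c)) gb ub wb kb kd' {kd}.
move=> G U W x y gb ub wb kb kd G0 x0.
have xx : x * x <= (1 / 2 - e) * (1 / 2 - e) by apply: ler_pM.
have ub' : U <= e / 4 * (1 / 2 - e) by apply: le_trans ub _; rewrite ler_wpM2l //; elra.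
have wb' : W <= e / 4 * (1 / 2 - e) by apply: le_trans wb _; rewrite ler_wpM2l //; elra.
have q0 : 0 < 1 / 2 - e / 2 by elra.
rewrite -(ler_pM2r q0).
(* This is (1/2 + e/2)(1/2 - e/2) - (1/2 - e)^2 - (e/2)(1/2 - e)(1/2 - e/2), the room left after
   multiplying the desired bound by 1/2 - e/2. *)
have e2 : 0 <= e * (7 / 8 - 7 / 8 * e - e * e / 4).
  apply: mulr_ge0; first by elra.
  have : e * e <= 1 * e by rewrite ler_pM2r //; elra.
  elra.
have : (U + W) * (1 / 2 - e / 2) <= (e / 4 * (1 / 2 - e) *+ 2) * (1 / 2 - e / 2).
  by rewrite ler_pM2r // mulr2n lerD.
move=> UW; rewrite (_ : (1 / 2 + e / 2) * (1 / 2 - e / 2) = (1 / 2 - e) * (1 / 2 - e)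
  + e / 4 * (1 / 2 - e) *+ 2 * (1 / 2 - e / 2) + e * (7 / 8 - 7 / 8 * e - e * e / 4)); last by field.
by rewrite -addrA mulrDl ler_wpDr // lerD // (le_trans gb).
Qed.

Lemma contracting_child' b c : contracting b c -> contracting (b + c) c.
Proof.
by move=> /contractingC/contracting_child/contractingC; rewrite [c + b]addrC.
Qed.

(* By [atom_quad] the norm of [atom v] can take the value [kap v] for no weight
   [t' <= t]; it starts below this value at [t' = 0] and depends continuously on
   [t']. *)
Lemma atom_le v : gcdz v.1 v.2 == 1 -> 2 < body (L P v * h) ->
  kap v <= 1 / 2 - e -> nm (atom P h v) <= kap v.
Proof.
move=> pv v2 kv; case: (lerP (nm (atom P h v)) (kap v)) => // lt_k; exfalso.
have s0 := slen_pos P h_pos pv.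
have k0 : 0 < kap v.
  by apply: lt_le_trans s0 _; apply: le_trans (ler_norm _) (wnorm_body _ t_ge0).
have /andP[b0 bs] := body_atom h_pos pv v2.
have [|t' /andP[t'0 t't] eqk] := @wnorm_ivt _ t (kap v) (atom P h v) t_ge0.
  apply/andP; split; last exact: ltW.
  rewrite ger0_norm //; apply: le_trans bs _.
  exact: le_trans (ler_norm _) (wnorm_body _ t_ge0).
have tt : 0 <= t' <= t by rewrite t'0.
have qE : atom P h v * (1 - (Wv P v * s v + atom P h v)) = s v * s v.
  by rewrite opprD addrA atom_quad.
have := wnorm_quot t'0 qE; rewrite eqk => H.
have {H} : kap v * (1 - wnorm t' (Wv P v * s v + atom P h v)) <= kap v * kap v.
  apply: le_trans H _; apply: le_trans (wnormM _ _ t'0) _.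
  by apply: ler_pM; rewrite ?wnorm_ge0 ?ler_wnorm.
rewrite ler_pM2l //.
have : wnorm t' (Wv P v * s v + atom P h v) <= e / 4 * kap v + kap v.
  apply: le_trans (wnormD _ _ t'0) _; rewrite eqk lerD2r.
  apply: le_trans (wnormM _ _ t'0) _; apply: ler_pM; rewrite ?wnorm_ge0 ?ler_wnorm //.
  by rewrite wnorm_W (le_trans (ler_wnorm _ tt)).
move: k0 kv; move: (kap v) (wnorm t' _) => x y x0 xk.
have : e / 4 * x <= e / 4 * 1 by rewrite ler_wpM2l //; elra.
elra.
Qed.

Lemma edge_atom_le b c : contracting b c -> nm (atom P h b) <= kap b.
Proof.
case=> ebc kb _ _; have [pb _ _] := edge_prim ebc.
by apply: atom_le => //; apply: edge_gt2 ebc.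
Qed.

Lemma alpha_le b c : contracting b c -> nm (alpha P h b) <= 2 * kap b.
Proof.
move=> bc; rewrite /alpha; apply: le_trans (wnormD _ _ t_ge0) _.
rewrite (_ : 2 * _ = kap b + 1 * kap b * 1); last by ring.
apply: lerD; first exact: edge_atom_le bc.
apply: le_trans (wnormM _ _ t_ge0) _; apply: ler_pM; rewrite ?wnorm_ge0 //.
  apply: le_trans (wnormM _ _ t_ge0) _; rewrite ler_wpM2r ?kap_ge0 // wnorm_W.
  by apply: le_trans theta_small _; elra.
by rewrite wnorm_const ger0_norm; elra.
Qed.

(** In a contracting pair kap b + kap c may come close to 1 - 2e, too large for the sum of products
    to shrink. If one of them is at most e/4, the sum is at most 1/2 - 3e/4, below the 1/2 - e/2 of
    [kapD]; [theta] is the quotient. *)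
Definition deep b c := contracting b c /\ (kap b <= e / 4 \/ kap c <= e / 4).

Lemma deep_child b c : deep b c -> deep b (b + c).
Proof.
case=> bc d; split; first exact: contracting_child.
right; case: d => [kb|kc]; first exact: le_trans (kapD_le bc) kb.
by rewrite addrC; apply: le_trans (kapD_le (contractingC bc)) kc.
Qed.

Lemma deepC b c : deep b c -> deep c b.
Proof. by case=> bc d; split; [exact: contractingC | case: d; [right|left]]. Qed.

Lemma deep_child' b c : deep b c -> deep (b + c) c.
Proof. by move=> /deepC/deep_child/deepC; rewrite [c + b]addrC. Qed.

Definition theta : R := (1 / 2 - 3 / 4 * e) / (1 / 2 - e / 2).

Lemma theta_bounds : 0 < theta < 1.
Proof. by rewrite /theta divr_gt0 ?ltr_pdivrMr /=; elra. Qed.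

Lemma deep_contract b c : deep b c ->
  kap b * kap (b + c) + kap (b + c) * kap c <= theta * (kap b * kap c).
Proof.
case=> bc d; have := kapD bc; have [_ kb kc _] := bc.
have := kap_ge0 b; have := kap_ge0 c; have := kap_ge0 (b + c).
have {d} : kap b + kap c <= 1 / 2 - 3 / 4 * e by case: d => ?; elra.
move: (kap b) (kap c) (kap (b + c)) => x y z xy z0 y0 x0 H.
have q0 : 0 < 1 / 2 - e / 2 by elra.
rewrite /theta mulrAC ler_pdivlMr // [x * z]mulrC -mulrDr.
rewrite mulrAC [leRHS]mulrC; apply: ler_pM => //; last by rewrite addr_ge0.
by rewrite mulr_ge0 // ltW.
Qed.

(** In [gap_factor] the cofactor has norm at most (1/2 + e/2) + (1/2 - e) + e/4 = 1 - e/4, and the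
    right side consists of five products bounded by kap b kap c; hence the constant 5 / (e/4). *)
Lemma gap_le b c : deep b c -> nm (gap P h b c) <= 20 / e * (kap b * kap c).
Proof.
case=> bc d; have [ebc kb kc pbc] := bc.
have qb := edge_atom_le bc; have qc := edge_atom_le (contractingC bc).
have H := wnorm_quot t_ge0 (gap_factor h_pos ebc).
have H1 : nm (psi P h b c + atom P h b + atom P h c) <= 1 - e / 4.
  apply: le_trans (wnormD _ _ t_ge0) _.
  have := wnormD (psi P h b c) (atom P h b) t_ge0.
  move: pbc qb qc kb kc d; move: (wnorm _ _) (wnorm _ _) (wnorm _ _) (wnorm _ _) (wnorm _ _) (wnorm _ _).
  by move=> x1 x2 x3 x4 x5 x6 h1 h2 h3 h4 h5 [] h6 h7; elra.
have {}H1 : e / 4 <= 1 - nm (psi P h b c + atom P h b + atom P h c).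
  by move: H1; move: (wnorm _ _) => x; elra.
have g0 : 0 <= nm (gap P h b c) by exact: wnorm_ge0.
have {H} H := le_trans (ler_wpM2l g0 H1) H.
have w1 v : nm (Wv P v) <= 1 by rewrite wnorm_W; apply: le_trans theta_small _; elra.
have M1 (x y : evgr N) kx ky : nm x <= kx -> nm y <= ky -> nm (x * y) <= kx * ky.
  by move=> hx hy; apply: le_trans (wnormM _ _ t_ge0) _; apply: ler_pM; rewrite ?wnorm_ge0.
suff S : nm (gap P h b c) * (e / 4) <= kap b * kap c * 5.
  rewrite (_ : 20 / e * _ = kap b * kap c * 5 / (e / 4)); last by field; rewrite gt_eqF.
  by rewrite ler_pdivlMr // divr_gt0.
apply: le_trans H _.
have A1 : nm (s b * s c * Wv P (b + c)) <= kap b * kap c * 1 by apply: (M1) => //; apply: (M1).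
have A2 : nm (atom P h b * (Wv P c * s c)) <= kap b * (1 * kap c) by apply: (M1) => //; apply: (M1).
have A3 : nm (atom P h c * (Wv P b * s b)) <= kap c * (1 * kap b) by apply: (M1) => //; apply: (M1).
have A4 : nm (atom P h b * atom P h c) <= kap b * kap c by apply: (M1).
apply: le_trans (wnormD _ _ t_ge0) _.
apply: le_trans (lerD (le_trans (wnormD _ _ t_ge0) (lerD (wnormD _ _ t_ge0) (lexx _))) (wnormD _ _ t_ge0)) _.
rewrite !mul1r mulr1 in A1 A2 A3; rewrite [kap c * _]mulrC in A3.
rewrite (_ : kap b * kap c * 5 = kap b * kap c + kap b * kap c + kap b * kap c
  + (kap b * kap c + kap b * kap c)); last by ring.
by rewrite !lerD.
Qed.

Local Notation size_alpha v := (nm (alpha P h v)).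
Local Notation tail n m b c :=
  (\sum_(v <- mediants m b c) size_alpha v - \sum_(v <- mediants n b c) size_alpha v).
Local Notation defect n b c := (gap P h b c -
  (\sum_(v <- mediants n b c) alpha P h v + \sum_(v <- mediants n b c) alpha P h v)).

Lemma tailS n m b c :
  tail n.+1 m.+1 b c = tail n m b (b + c) + tail n m (b + c) c.
Proof. by rewrite !sum_mediantsS; ring. Qed.

(** Iterated, this shows that [defect n b c] is the sum of the gaps of the 2^n intervals at depth
    n. *)
Lemma defectS n b c : edge P h b c ->
  defect n.+1 b c = defect n b (b + c) + defect n (b + c) c.
Proof. by move=> bc; rewrite (gapD h_pos bc) !sum_mediantsS; ring. Qed.

(** The constant C solves C = 8 + theta C. The 8 comes from [alpha_le], with factor 2, and from kap
    (b + c) <= 4 kap b kap c, as 1/2 - e/2 > 1/4. *)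
Lemma deep_sum n b c : deep b c ->
  \sum_(v <- mediants n b c) size_alpha v <= 8 / (1 - theta) * (kap b * kap c).
Proof.
have /andP[th0 th1] := theta_bounds.
have C0 : 0 <= 8 / (1 - theta) by rewrite divr_ge0 // subr_ge0 ltW.
elim: n b c => [|n IH] b c bc.
  by rewrite big_nil !mulr_ge0 ?kap_ge0 // invr_ge0 subr_ge0 ltW.
rewrite sum_mediantsS.
have fd : size_alpha (b + c) <= 8 * (kap b * kap c).
  apply: le_trans (alpha_le (contracting_child' bc.1)) _.
  have := kapD bc.1; have := kap_ge0 (b + c).
  move: (kap (b + c)) (kap b * kap c) => x y x0 H.
  have : 0 <= x * (1 / 2 - e) by rewrite mulr_ge0 //; elra.
  elra.
apply: le_trans (lerD fd (lerD (IH _ _ (deep_child bc)) (IH _ _ (deep_child' bc)))) _.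
rewrite -mulrDr; apply: le_trans (lerD (lexx _) (ler_wpM2l C0 (deep_contract bc))) _.
rewrite (mulrA (8 / (1 - theta))) -mulrDl ler_wpM2r ?mulr_ge0 ?kap_ge0 //.
rewrite (_ : 8 + _ = 8 / (1 - theta)) //; field.
by rewrite subr_eq0 gt_eqF.
Qed.

Lemma deep_tail n m b c : deep b c -> (n <= m)%N ->
  tail n m b c <= theta ^+ n * (8 / (1 - theta) * (kap b * kap c)).
Proof.
have /andP[th0 th1] := theta_bounds.
elim: n m b c => [|n IH] [|m] b c bc // nm.
- rewrite subrr !mulr_ge0 ?kap_ge0 ?exprn_ge0 ?invr_ge0 ?subr_ge0 //; exact: ltW.
- by rewrite [X in _ - X]big_nil subr0 expr0 mul1r deep_sum.
rewrite tailS; apply: le_trans (lerD (IH _ _ _ (deep_child bc) nm) (IH _ _ _ (deep_child' bc) nm)) _.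
rewrite -mulrDr -mulrDr exprSr -[leRHS]mulrA ler_wpM2l ?exprn_ge0 ?(ltW th0) //.
rewrite [leRHS]mulrCA ler_wpM2l ?deep_contract //.
by rewrite divr_ge0 // subr_ge0 ltW.
Qed.

Lemma deep_defect n b c : deep b c ->
  nm (defect n b c) <= theta ^+ n * (20 / e * (kap b * kap c)).
Proof.
have /andP[th0 th1] := theta_bounds.
elim: n b c => [|n IH] b c bc.
  by rewrite big_nil addr0 subr0 expr0 mul1r gap_le.
rewrite defectS; last by case: bc.1.
apply: le_trans (wnormD _ _ t_ge0) _.
apply: le_trans (lerD (IH _ _ (deep_child bc)) (IH _ _ (deep_child' bc))) _.
rewrite -mulrDr -mulrDr exprSr -[leRHS]mulrA ler_wpM2l ?exprn_ge0 ?(ltW th0) //.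
rewrite [leRHS]mulrCA ler_wpM2l ?deep_contract //.
by rewrite divr_ge0 // ltW.
Qed.

(** The interval carries no mass besides its atoms, and their series converges absolutely. Without a
    rate the property passes from the two halves of an interval to the whole. *)
Definition atomic b c := forall eps : R, 0 < eps -> exists n0, forall n, (n0 <= n)%N ->
  nm (defect n b c) <= eps /\ forall m, (n <= m)%N -> tail n m b c <= eps.

Lemma deep_atomic b c : deep b c -> atomic b c.
Proof.
move=> bc eps eps0; have thb := theta_bounds; have /andP[th0 th1] := thb.
have kk : 0 <= kap b * kap c by rewrite mulr_ge0 ?kap_ge0.
have [|n1 H1] := @small_exp theta (20 / e * (kap b * kap c)) eps thb _ eps0.
  by rewrite mulr_ge0 // divr_ge0 // ltW.
have [|n2 H2] := @small_exp theta (8 / (1 - theta) * (kap b * kap c)) eps thb _ eps0.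
  by rewrite mulr_ge0 // divr_ge0 // subr_ge0 ltW.
exists (maxn n1 n2) => n; rewrite geq_max => /andP[/H1 d1 /H2 d2]; split.
  exact: le_trans (deep_defect _ bc) d1.
by move=> m nm; apply: le_trans (deep_tail bc nm) d2.
Qed.

Lemma atomic_split b c : edge P h b c ->
  atomic b (b + c) -> atomic (b + c) c -> atomic b c.
Proof.
move=> bc H1 H2 eps eps0; have eps2 : 0 < eps / 2 by rewrite divr_gt0.
have [n1 {}H1] := H1 _ eps2; have [n2 {}H2] := H2 _ eps2.
exists (maxn n1 n2).+1 => -[|n] //; rewrite ltnS geq_max => /andP[/H1[d1 t1] /H2[d2 t2]].
rewrite (splitr eps) defectS //; split.
  by apply: le_trans (wnormD _ _ t_ge0) _; apply: lerD.
by case=> [//|m] nm; rewrite tailS; apply: lerD; [apply: t1 | apply: t2].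
Qed.

(** Both children contain the vertex b + c, whose kap is at most r times that of either parent. So
    after finitely many subdivisions all intervals are deep; j counts the subdivisions still
    allowed. *)
Lemma contracting_atomic b c : contracting b c -> atomic b c.
Proof.
pose r : R := (1 / 2 - e) / (1 / 2 - e / 2).
have q0 : 0 < 1 / 2 - e / 2 by elra.
have rb : 0 < r < 1 by rewrite /r divr_gt0 ?ltr_pdivrMr //=; elra.
have shrink u v : contracting u v -> kap (u + v) <= r * kap u.
  by move=> uv; rewrite /r mulrAC ler_pdivlMr // [leRHS]mulrC kapD_lt.
have ind j : forall u v, contracting u v -> r ^+ j * kap u <= e / 4 \/ r ^+ j * kap v <= e / 4 ->
    atomic u v.
  elim: j => [|j IH] u v uv H.
    by apply: deep_atomic; split=> //; move: H; rewrite expr0 !mul1r.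
  have kd : r ^+ j * kap (u + v) <= e / 4.
    have rj : 0 <= r ^+ j by rewrite exprn_ge0 // ltW //; case/andP: rb.
    case: H => [Hu|Hv].
      by apply: le_trans Hu; rewrite exprSr -mulrA ler_wpM2l ?shrink.
    apply: le_trans Hv; rewrite exprSr -mulrA ler_wpM2l // addrC.
    exact/shrink/contractingC.
  apply: atomic_split; first by case: uv.
    by apply: IH; [exact: contracting_child | right].
  by apply: IH; [exact: contracting_child' | left].
move=> bc; have [|n0 H] := @small_exp r (kap b) (e / 4) rb (kap_ge0 b).
  by rewrite divr_gt0.
by apply: (ind n0) => //; left; apply: H.
Qed.

End Decay.

(** * Enumeration of the arcs and existence of a sink *)

Section FareyTree.
Implicit Types (b c u v : int * int).

(** Subtractive Euclidean algorithm: the larger of m and n selects the child interval, and each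
    descent lowers m + n. *)
Lemma mediants_mem k m n b c : (0 < m)%N -> (0 < n)%N -> coprime m n ->
  (m + n <= k.+1)%N -> b *+ m + c *+ n \in mediants k b c.
Proof.
elim: k m n b c => [|k IH] m n b c m0 n0 mn mnk; first by lia.
rewrite /= inE mem_cat; case: (ltngtP m n) => [lt_mn|lt_nm|eq_mn].
- rewrite [X in [|| _, _ | X]](_ : _ = true) ?orbT //.
  rewrite (_ : b *+ m + c *+ n = (b + c) *+ m + c *+ (n - m)); last first.
    by rewrite mulrnDl -addrA -mulrnDr subnKC // ltnW.
  apply: IH => //; rewrite ?subn_gt0 //; last by lia.
  by rewrite /coprime -gcdnDr subnK ?(ltnW lt_mn).
- rewrite [X in [|| _, X | _]](_ : _ = true) ?orbT //.
  rewrite (_ : b *+ m + c *+ n = b *+ (m - n) + (b + c) *+ n); last first.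
    by rewrite mulrnDl addrA -mulrnDr subnK // ltnW.
  apply: IH => //; rewrite ?subn_gt0 //; last by lia.
  by rewrite coprime_sym /coprime -gcdnDr subnK ?(ltnW lt_nm) // gcdnC.
- by move: mn; rewrite eq_mn /coprime gcdnn => /eqP ->; rewrite eqxx.
Qed.

Lemma sub_mediants n m b c : (n <= m)%N -> {subset mediants n b c <= mediants m b c}.
Proof.
elim: n m b c => [|n IH] [|m] b c // nm v.
rewrite /= !inE !mem_cat => /or3P[->//|/(IH m)->//|/(IH m)->//]; by rewrite ?orbT.
Qed.

(** Mediants lie strictly inside the cone of b and c; the factor d covers both orientations. The two
    subtrees therefore lie in disjoint cones. *)
Lemma mediants_det n b c (d := vdet b c) v : d * d = 1 -> v \in mediants n b c ->
  0 < d * vdet b v /\ 0 < d * vdet v c.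
Proof.
elim: n b c @d => // n IH b c d dd; rewrite inE mem_cat => /or3P[/eqP->|H|H].
- by rewrite vdetDr vdetDl !vdet_self add0r addr0 dd.
- have dE : vdet b (b + c) = d by rewrite vdetDr vdet_self add0r.
  have [] := IH b (b + c); rewrite ?dE // [vdet v (b + c)]vdetDr [vdet v b]vdetC [d * (- _ + _)]mulrDr mulrN.
  by move: (d * _) (d * _) => x y; lia.
- have dE : vdet (b + c) c = d by rewrite vdetDl vdet_self addr0.
  have [] := IH (b + c) c; rewrite ?dE // vdetDl [vdet c v]vdetC [d * (_ + - _)]mulrDr mulrN.
  by move: (d * _) (d * _) => x y; lia.
Qed.

Lemma mediants_uniq n b c : vdet b c * vdet b c = 1 -> uniq (mediants n b c).
Proof.
elim: n b c => // n IH b c dd.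
have d1 : vdet b (b + c) = vdet b c by rewrite vdetDr vdet_self add0r.
have d2 : vdet (b + c) c = vdet b c by rewrite vdetDl vdet_self addr0.
have l v := @mediants_det n b (b + c) v; have r v := @mediants_det n (b + c) c v.
rewrite d1 in l; rewrite d2 in r.
rewrite /= mem_cat negb_or cat_uniq !IH ?d1 ?d2 //= andbT -andbA; apply/and3P; split.
- by apply/negP => /(l _ dd)[_]; rewrite vdet_self mulr0.
- by apply/negP => /(r _ dd)[]; rewrite vdet_self mulr0.
- apply/hasPn => v /(r _ dd)[rv _]; apply/negP => /(l _ dd)[_ lv].
  by move: rv lv; rewrite [vdet v _]vdetC mulrN; move: (_ * _) => x; lia.
Qed.

Lemma mediants_prim n b c v : adjacent b c -> v \in mediants n b c -> gcdz v.1 v.2 == 1.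
Proof.
elim: n b c => // n IH b c bc; rewrite inE mem_cat.
have db : adjacent b (b + c) by rewrite adjacentDr.
have dc : adjacent (b + c) c by rewrite adjacentC addrC adjacentDr adjacentC.
case/or3P=> [/eqP->|/(IH _ _ db)//|/(IH _ _ dc)//].
exact: adjacent_prim dc.
Qed.

(** The cones of (b, c) and (b, -c) fill a half-plane, so each primitive vector should appear in the
    limit exactly once up to sign. *)
Definition farey n b c := [:: b, c & mediants n b c ++ mediants n b (- c)].
Definition farey_arcs n b c := map nrm (farey n b c).

Lemma adjacent_sq b c : adjacent b c -> vdet b c * vdet b c = 1.
Proof. by rewrite /adjacent; lia. Qed.

Lemma farey_prim n b c v : adjacent b c -> v \in farey n b c -> gcdz v.1 v.2 == 1.
Proof.
move=> bc; rewrite !inE mem_cat => /or4P[/eqP->|/eqP->||].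
- exact: adjacent_prim bc.
- by rewrite adjacentC in bc; apply: adjacent_prim bc.
- exact: mediants_prim.
- by apply: mediants_prim; rewrite adjacentNr.
Qed.

Lemma farey_arcb n b c : adjacent b c -> all arcb (farey_arcs n b c).
Proof. by move=> bc; apply/allP => w /mapP[v /(farey_prim bc) pv ->]; apply: arc_nrm. Qed.

Lemma farey_uniq n b c : adjacent b c -> uniq (farey_arcs n b c).
Proof.
move=> bc; have dd := adjacent_sq bc.
have ddN : vdet b (- c) * vdet b (- c) = 1 by rewrite vdetNr mulrNN.
have up v := @mediants_det n b c v dd.
have dn v := @mediants_det n b (- c) v ddN.
rewrite map_inj_in_uniq.
  rewrite /= !inE !mem_cat !negb_or cat_uniq !mediants_uniq //= andbT.
  apply/and3P; split.
  - apply/and3P; split.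
    + by apply: contra_eq_neq dd => ->; rewrite vdet_self mul0r.
    + by apply/negP => /up[]; rewrite vdet_self mulr0.
    + by apply/negP => /dn[]; rewrite vdet_self mulr0.
  - apply/andP; split.
      by apply/negP => /up[_]; rewrite vdet_self mulr0.
    by apply/negP => /dn[_]; rewrite !vdetNr vdet_self oppr0 mulr0.
  - apply/hasPn => v /dn[H _]; apply/negP => /up[H' _].
    by move: H H'; rewrite vdetNr mulNr; move: (_ * _) => x; lia.
(* Each vector of the list is c or lies strictly on one side of the line through c. No two are
   opposite, so [nrm] is injective on the list. *)
have side v : v \in farey n b c -> v = c \/ 0 < vdet b c * vdet v c.
  rewrite !inE mem_cat => /or4P[/eqP->|/eqP->|/up[_ ->]|/dn[_]]; [|by left|by right|].
    by right; rewrite dd.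
  by rewrite !vdetNr mulrNN; right.
move=> u v /side su /side sv e.
have [//|e'] : u = v \/ u = - v.
  case: (nrmE u) e => ->; case: (nrmE v) => -> e; [by left|by right| |].
    by right; rewrite -e opprK.
  by left; apply: oppr_inj.
have vN w : vdet (- w) c = - vdet w c by rewrite /vdet /=; ring.
exfalso; case: su => [uc|su]; case: sv => [vc|sv]; move: e'.
- by rewrite uc vc => /(congr1 (vdet b)) H; move: dd; rewrite {1}H vdetNr; lia.
- by rewrite uc => /(congr1 (vdet^~ c)) H; move: sv H; rewrite vN vdet_self; lia.
- by rewrite vc => H; move: su; rewrite H vN vdet_self oppr0 mulr0.
- by move=> H; move: su; rewrite H vN mulrN; lia.
Qed.

(** Cramer's rule in the basis (b, c): dividing by the determinant is multiplying by it, since its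
    square is 1. *)
Lemma prim_coprime b c v (x := vdet b c * vdet v c) (y := vdet b c * vdet b v) :
  adjacent b c -> gcdz v.1 v.2 == 1 ->
  [/\ v = (x * b.1 + y * c.1, x * b.2 + y * c.2) & coprime `|x|%N `|y|%N].
Proof.
move=> bc pv; have dd := adjacent_sq bc.
have vE : v = (x * b.1 + y * c.1, x * b.2 + y * c.2).
  rewrite [LHS]surjective_pairing; congr pair.
    rewrite -[LHS]mul1r -dd /x /y /vdet; ring.
  rewrite -[LHS]mul1r -dd /x /y /vdet; ring.
split=> //; have : (gcdz x y %| gcdz v.1 v.2)%Z.
  by rewrite dvdz_gcd vE /= !rpredD // dvdz_mulr ?dvdz_gcdl ?dvdz_gcdr.
by rewrite (eqP pv) dvdz1 absz_nat.
Qed.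

Lemma arc_farey b c v : adjacent b c -> arcb v -> exists n, v \in farey_arcs n b c.
Proof.
move=> bc av; have pv : gcdz v.1 v.2 == 1 by case/andP: av.
have [vE co] := prim_coprime bc pv; rewrite -(nrm_arc av).
move: (vdet b c * _) (vdet b c * _) vE co => y x vE co.
exists (`|x| + `|y|)%N.
(* The sign of the x-coordinate decides between v and -v, and the relative sign of x and y decides
   between the two cones. *)
suff [H|H] : v \in farey (`|x| + `|y|)%N b c \/ - v \in farey (`|x| + `|y|)%N b c.
- exact: map_f.
- by rewrite -nrmN; apply: map_f.
rewrite !inE !mem_cat.
have natE (m n : nat) (w : int * int) :
    b *+ m + w *+ n = (m%:Z * b.1 + n%:Z * w.1, m%:Z * b.2 + n%:Z * w.2).
  have zE (k : nat) (z : int) : z *+ k = k%:Z * z by rewrite -mulr_natl natz.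
  by rewrite !pairMnE -!zE.
have in_cone (w : int * int) : (0 < `|x|)%N -> (0 < `|y|)%N ->
    b *+ `|x| + w *+ `|y| \in mediants (`|x| + `|y|) b w.
  by move=> x0 y0; exact: (mediants_mem b w x0 y0 co (leqnSn _)).
have [x0|x0] := eqVneq x 0.
  have y1 : `|y|%N = 1%N by move: co; rewrite x0 /coprime gcd0n => /eqP.
  have [ey|ey] : y = 1 \/ y = -1 by lia.
    by left; rewrite vE x0 ey !mul0r !add0r !mul1r -surjective_pairing eqxx orbT.
  right; rewrite vE x0 ey !mul0r !add0r !mulN1r.
  by rewrite (_ : - (- c.1, - c.2) = c) ?eqxx ?orbT // -[(- _, - _)]/(- c) opprK.
have [y0|y0] := eqVneq y 0.
  have x1 : `|x|%N = 1%N by move: co; rewrite y0 /coprime gcdn0 => /eqP.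
  have [ex|ex] : x = 1 \/ x = -1 by lia.
    by left; rewrite vE y0 ex !mul0r !addr0 !mul1r -surjective_pairing eqxx.
  right; rewrite vE y0 ex !mul0r !addr0 !mulN1r.
  by rewrite (_ : - (- b.1, - b.2) = b) ?eqxx // -[(- _, - _)]/(- b) opprK.
have px : (0 < `|x|)%N by rewrite absz_gt0.
have py : (0 < `|y|)%N by rewrite absz_gt0.
have {}in_cone w : b *+ `|x| + w *+ `|y| \in mediants (`|x| + `|y|) b w by exact: in_cone.
have [sx|sx] : `|x|%N%:Z = x \/ `|x|%N%:Z = - x by lia.
- left; rewrite vE; have [sy|sy] : `|y|%N%:Z = y \/ `|y|%N%:Z = - y by lia.
    by have := in_cone c; rewrite natE sx sy => ->; rewrite !orbT.
  have := in_cone (- c); rewrite natE sx sy /= !mulrNN => ->; by rewrite !orbT.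
- right; rewrite vE; have [sy|sy] : `|y|%N%:Z = y \/ `|y|%N%:Z = - y by lia.
    have := in_cone (- c); rewrite natE sx sy /= !mulrN !mulNr -!opprD => H.
    by rewrite -[- (_, _)]/(- _, - _) H !orbT.
  have := in_cone c; rewrite natE sx sy /= !mulNr -!opprD => H.
  by rewrite -[- (_, _)]/(- _, - _) H !orbT.
Qed.

Lemma sub_farey_arcs n m b c : (n <= m)%N ->
  {subset farey_arcs n b c <= farey_arcs m b c}.
Proof.
move=> nm w /mapP[v vn ->]; apply: map_f; move: vn; rewrite !inE !mem_cat.
by case/or4P=> [->|->|/(sub_mediants nm)->|/(sub_mediants nm)->]; rewrite ?orbT.
Qed.

Lemma sub_arcs_farey b c s : adjacent b c -> all arcb s ->
  exists n, forall m, (n <= m)%N -> {subset s <= farey_arcs m b c}.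
Proof.
move=> bc; elim: s => [|v s IH] /=; first by exists 0%N.
case/andP=> av /IH[n Hn]; have [k vk] := arc_farey bc av.
exists (maxn n k) => m; rewrite geq_max => /andP[nm km] w; rewrite inE => /predU1P[->|].
  exact: sub_farey_arcs vk.
exact: Hn.
Qed.

Lemma farey_sum (V : nmodType) (f : int * int -> V) n b c :
  (forall v, gcdz v.1 v.2 == 1 -> f (nrm v) = f v) -> adjacent b c ->
  \sum_(v <- farey_arcs n b c) f v = f b + f c +
    (\sum_(v <- mediants n b c) f v + \sum_(v <- mediants n b (- c)) f v).
Proof.
move=> fn bc; rewrite big_map big_seq.
under eq_bigr => v /(farey_prim bc) pv do rewrite fn //.
by rewrite -big_seq !big_cons big_cat addrA.
Qed.

End FareyTree.

(** From the relation det(a,b) c = det(a,c) b - det(b,c) a, in which all three determinants are 1 or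
    -1. *)
Lemma adjacent3 a b c : adjacent a b -> adjacent b c -> adjacent a c ->
  exists b', [/\ b' = b \/ b' = - b & c = a + b' \/ c = - (a + b')].
Proof.
rewrite /adjacent => ab bc ac.
have e1 : vdet a b * c.1 = vdet a c * b.1 - vdet b c * a.1 by rewrite /vdet; ring.
have e2 : vdet a b * c.2 = vdet a c * b.2 - vdet b c * a.2 by rewrite /vdet; ring.
have sgn (x : int) : `|x| == 1 -> x = 1 \/ x = -1 by lia.
have eqv (u v : int * int) : u.1 = v.1 -> u.2 = v.2 -> u = v by case: u v => [? ?] [? ?] /= -> ->.
case: (sgn _ ab) => E1; case: (sgn _ bc) => E2; case: (sgn _ ac) => E3;
  rewrite E1 E2 E3 in e1 e2;
  first [ by exists b; split; [left | left; apply: eqv => /=; lia]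
        | by exists b; split; [left | right; apply: eqv => /=; lia]
        | by exists (- b); split; [right | left; apply: eqv => /=; lia]
        | by exists (- b); split; [right | right; apply: eqv => /=; lia] ].
Qed.

Section UniqSums.
Variables (T : eqType) (V : nmodType) (f : T -> V).
Lemma sum_uniq_split (s s0 : seq T) : uniq s -> uniq s0 -> {subset s0 <= s} ->
  \sum_(v <- s) f v = \sum_(v <- s0) f v + \sum_(v <- s | v \notin s0) f v.
Proof.
move=> us us0 sub; rewrite (bigID (mem s0)) /=; congr (_ + _).
rewrite -big_filter; apply: perm_big; apply: uniq_perm => //; first exact: filter_uniq.
move=> v; rewrite mem_filter; apply/andP/idP => [[]//|v0]; split=> //; exact: sub.
Qed.
End UniqSums.

Lemma ler_sum_uniq (T : eqType) (f : T -> R) (s s' : seq T) : (forall v, 0 <= f v) ->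
  uniq s -> uniq s' -> {subset s <= s'} -> \sum_(v <- s) f v <= \sum_(v <- s') f v.
Proof.
by move=> f0 us us' sub; rewrite (sum_uniq_split f us' us sub) lerDl sumr_ge0.
Qed.

(** * Descent to a sink of the flip graph, on bodies *)

Section Sink.
Variables (N : nat) (P : STT N) (h : evgr N).
Hypothesis h_pos : 0 < body h.
Implicit Types b c : int * int.
Local Notation x v := (body (L P v * h)).

Lemma edge_x_pos b c : edge P h b c -> [/\ 0 < x b, 0 < x c & 0 < x (b + c)].
Proof. by move=> bc; have [pb pc pd] := edge_prim bc; rewrite !body_Lh. Qed.

Lemma xN v : x (- v) = x v. Proof. by rewrite LN. Qed.

Lemma edge_rot b c : edge P h b c -> edge P h (b + c) (- b).
Proof. by move=> bc; apply/edgeNr/edgeC/edgeD. Qed.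

Lemma x_flip b c : edge P h b c -> x (b - c) * x (b + c) = x b ^+ 2 + x c ^+ 2.
Proof.
case=> bc _; have := congr1 (@body N) (ptolemy_ev P bc).
rewrite !(rmorphD, rmorphM) /= body_W mulr0 addr0 => e.
transitivity (body (L P (b - c)) * body (L P (b + c)) * body h ^+ 2); first by ring.
by rewrite e; ring.
Qed.

(** By [x_flip], flipping one arc replaces its x by the sum of the squares of the other two divided
    by x; each inequality says that such a flip does not shorten. *)
Definition sink b c := [/\ x b ^+ 2 <= x c ^+ 2 + x (b + c) ^+ 2,
  x c ^+ 2 <= x b ^+ 2 + x (b + c) ^+ 2 & x (b + c) ^+ 2 <= x b ^+ 2 + x c ^+ 2].

(* Flipping away an arc with [x d ^ 2 > x b ^ 2 + x c ^ 2] shortens it by more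
   than [8 / M] as soon as the new triangulation is not a sink either, so the
   descent stops. *)
Lemma sink_descent (M : R) n b c : edge P h b c -> 0 < M -> x b + x c + x (b + c) <= M ->
  x b + x c + x (b + c) <= n%:R * (8 / M) -> x b ^+ 2 + x c ^+ 2 < x (b + c) ^+ 2 ->
  exists b' c', edge P h b' c' /\ sink b' c'.
Proof.
move=> + M0; elim: n b c => [|n IH] b c bc leM len bad.
  by have [xb xc xd] := edge_x_pos bc; move: len; rewrite mul0r leNgt !addr_gt0.
have [xb xc xd] := edge_x_pos bc.
have bc' := edgeNr bc; have fl := x_flip bc; have [_ _ xa] := edge_x_pos bc'.
have a_lt_d : x (b - c) < x (b + c).
  by rewrite -(ltr_pM2r xd) fl -expr2.
have dM : x (b - c) <= M.
  by move: leM a_lt_d xb xc; move: (x b) (x c) (x (b + c)) (x (b - c)) => *; lra.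
(* Put a = b - c and d = b + c. If b is now too long, x_b^2 > x_c^2 + x_a^2 and [x_flip] give x_a
   (x_d - x_a) > 2 x_c^2 > 8, where x_a <= M; likewise with b and c exchanged. *)
have dec (y : R) : 2 < y -> y ^+ 2 *+ 2 < x (b - c) * x (b + c) - x (b - c) ^+ 2 ->
    8 / M <= x (b + c) - x (b - c).
  move=> y2 H; rewrite ler_pdivrMr // mulrC.
  apply: (@le_trans _ _ (x (b - c) * (x (b + c) - x (b - c)))); last first.
    by rewrite ler_wpM2r // subr_ge0 ltW.
  rewrite mulrBr -expr2; apply: le_trans (ltW H); rewrite mulr2n expr2.
  have : 2 * 2 < y * y by rewrite ltr_pM.
  by move: (y * y) => z; lra.
have step u v : edge P h u v -> x u + x v + x (u + v) = x b + x c + x (b - c) ->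
    x u ^+ 2 + x v ^+ 2 < x (u + v) ^+ 2 -> 8 / M <= x (b + c) - x (b - c) ->
    exists b' c', edge P h b' c' /\ sink b' c'.
  move=> uv T badu dl; apply: (IH u v) => //; rewrite T.
    by move: leM a_lt_d; move: (x b) (x c) (x (b + c)) (x (b - c)) => *; lra.
  move: len dl; rewrite -natr1 mulrDl mul1r; move: (8 / M) => d; move: (_ * d) => K.
  by move: (x b) (x c) (x (b + c)) (x (b - c)) => *; lra.
have c2 := edge_gt2 h_pos (edgeC bc); have b2 := edge_gt2 h_pos bc.
have [okb|badb] := lerP (x b ^+ 2) (x c ^+ 2 + x (b - c) ^+ 2); last first.
  have bE : b - c + c = b by rewrite subrK.
  apply: (step (b - c) c); rewrite ?bE.
  - by have := edgeNr (edgeC (edgeD (edgeC bc'))); rewrite opprK addrC.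
  - ring.
  - by rewrite addrC.
  - by apply: (dec _ c2); rewrite fl mulr2n; move: badb; move: (_ ^+ 2) (_ ^+ 2) (_ ^+ 2) => *; lra.
have [okc|badc] := lerP (x c ^+ 2) (x b ^+ 2 + x (b - c) ^+ 2); last first.
  have cE : b + - (b - c) = c by rewrite subKr.
  apply: (step b (- (b - c))); rewrite ?cE ?xN.
  - exact/edgeNr/(edgeD).
  - ring.
  - by [].
  - by apply: (dec _ b2); rewrite fl mulr2n; move: badc; move: (_ ^+ 2) (_ ^+ 2) (_ ^+ 2) => *; lra.
exists b, (- c); split=> //; split; rewrite ?xN //.
rewrite -fl expr2 ler_wpM2l; [by []|exact: ltW|exact: ltW].
Qed.

Lemma sink_exists b c : edge P h b c -> exists b' c', edge P h b' c' /\ sink b' c'.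
Proof.
have descend u v : edge P h u v -> x u ^+ 2 + x v ^+ 2 < x (u + v) ^+ 2 ->
    exists b' c', edge P h b' c' /\ sink b' c'.
  move=> uv bad; have [xu xv xd] := edge_x_pos uv.
  pose M := x u + x v + x (u + v); have M0 : 0 < M by rewrite !addr_gt0.
  (* The perimeter M drops by at least 8 / M each time, so more than M / (8 / M) rounds cannot
     occur. *)
  have := @sink_descent M (Num.truncn (M / (8 / M))).+1 _ _ uv M0 (lexx _); apply => //.
  by rewrite -ler_pdivrMr ?divr_gt0 // ltW // truncnS_gt.
move=> bc; have [H1|/descend] := lerP (x (b + c) ^+ 2) (x b ^+ 2 + x c ^+ 2); last exact.
have [H2|H] := lerP (x c ^+ 2) (x b ^+ 2 + x (b + c) ^+ 2); last first.
  apply: (descend (b + c) (- b)); first exact: edge_rot.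
  by rewrite xN addrAC subrr add0r addrC.
have [H3|H] := lerP (x b ^+ 2) (x c ^+ 2 + x (b + c) ^+ 2); last first.
  apply: (descend (c + b) (- c)); first exact/edge_rot/edgeC.
  by rewrite xN addrAC subrr add0r addrC [c + b]addrC.
by exists b, c.
Qed.

Lemma body_psi b c : edge P h b c -> body (psi P h b c) = x (b - c) / (x b * x c).
Proof.
move=> bc; have [pb pc _] := edge_prim bc.
rewrite psiE // !(rmorphD, rmorphM) /= !body_W !mul0r !addr0 !body_slen // !rmorphM /=.
by rewrite !invfM; ring.
Qed.

(** By the Markov equation for b, c and a = b - c, the body of psi equals x_a^2 / (x_a^2 + x_b^2 +
    x_c^2). *)
Lemma body_psi_le b c : edge P h b c ->
  x (b - c) ^+ 2 <= x b ^+ 2 + x c ^+ 2 -> 0 <= body (psi P h b c) <= 1 / 2.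
Proof.
move=> bc le; have [xb xc _] := edge_x_pos bc.
have [_ _ xa] := edge_x_pos (edgeNr bc).
rewrite body_psi // divr_ge0 ?mulr_ge0 ?(ltW xb) ?(ltW xc) ?(ltW xa) //=.
rewrite ler_pdivrMr ?mulr_gt0 //.
have mk := body_markov (edgeNr bc).
rewrite /= xN in mk.
rewrite -(ler_pM2r xa) -mulrA mk -expr2; move: le.
by move: (_ ^+ 2) (_ ^+ 2) (_ ^+ 2) => *; lra.
Qed.

End Sink.

(** * The sum over all arcs *)

Lemma small_weight N (l : seq (evgr N)) (d : R) : 0 < d ->
  exists2 t, 0 < t <= 1 & forall x, x \in l -> wnorm t x <= `|body x| + d.
Proof.
move=> d0; pose K := \sum_(x <- l) grnorm (evval x).
have gr0 (x : evgr N) : 0 <= grnorm (evval x) by rewrite -wnorm1 wnorm_ge0.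
have K0 : 0 <= K by apply: sumr_ge0.
have K1 : 0 < K + 1 by rewrite ltr_wpDl.
pose t := Num.min 1 (d / (K + 1)).
have t0 : 0 < t by rewrite lt_min ltr01 divr_gt0.
have t1 : t <= 1 by rewrite ge_min lexx.
exists t; rewrite ?t0 // => x xl.
apply: le_trans (wnorm_small _ _) _; first by rewrite ltW.
rewrite lerD2l; apply: (@le_trans _ _ (t * (K + 1))); last first.
  by rewrite -ler_pdivlMr // ge_min lexx orbT.
rewrite ler_wpM2l ?(ltW t0) // ler_wpDr // /K (perm_big _ (perm_to_rem xl)) big_cons.
by rewrite lerDl sumr_ge0.
Qed.

Section Total.
Variables (N : nat) (P : STT N) (h : evgr N).
Hypothesis h_pos : 0 < body h.
Implicit Types b c : int * int.

Lemma alpha_nrm v : gcdz v.1 v.2 == 1 -> alpha P h (nrm v) = alpha P h v.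
Proof. by move=> pv; rewrite /alpha /atom /rarc /xarc /slen W_nrm L_nrm // arc_nrm. Qed.

(** The psi of the intervals (b, d), (d, c), (b, -c) involve the opposite arcs c, b, d respectively,
    so the three sink inequalities bound exactly these three bodies by 1/2. *)
Lemma sink_contracting b c : edge P h b c -> sink P h b c ->
  exists t e, [/\ 0 < t <= 1, 0 < e < 1 / 2 & wnorm t (theta12 P) <= e / 4] /\
    [/\ contracting P h t e b (b + c), contracting P h t e (b + c) c
    & contracting P h t e b (- c)].
Proof.
move=> bc [Sb Sc Sd]; set d := b + c.
have [pb pc pd] := edge_prim bc.
have bd := edgeD bc; have dc : edge P h d c by have := edgeC (edgeD (edgeC bc)); rewrite addrC.
have bc' := edgeNr bc.
have slt v : gcdz v.1 v.2 == 1 -> 2 < body (L P v * h) -> 0 < body (slen P h v) < 1 / 2.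
  move=> pv v2; rewrite slen_pos //= body_slen // div1r ltf_pV2 // posrE //.
  by rewrite (lt_trans _ v2).
have /andP[sb0 sb] := slt b pb (edge_gt2 h_pos bc).
have /andP[sc0 sc] := slt c pc (edge_gt2 h_pos (edgeC bc)).
have /andP[sd0 sd] := slt d pd (edge_gt2 h_pos dc).
have xN v : body (L P (- v) * h) = body (L P v * h) by rewrite LN.
have /andP[p10 p1] : 0 <= body (psi P h b d) <= 1 / 2.
  by apply: body_psi_le => //; rewrite /d opprD addNKr xN.
have /andP[p20 p2] : 0 <= body (psi P h d c) <= 1 / 2.
  by apply: body_psi_le => //; rewrite /d addrK addrC.
have /andP[p30 p3] : 0 <= body (psi P h b (- c)) <= 1 / 2.
  by apply: body_psi_le => //; rewrite opprK xN.
pose m := Num.max (body (slen P h b)) (Num.max (body (slen P h c)) (body (slen P h d))).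
have m0 : 0 < m by rewrite lt_max sb0.
have mlt : m < 1 / 2 by rewrite !gt_max sb sc sd.
(* Then m + e = 1/2 - e, so soul contributions of size e/4 fit below the bound on [slen]. *)
pose e := (1 / 2 - m) / 2.
have e0 : 0 < e by rewrite divr_gt0 // subr_gt0.
have eh : e < 1 / 2 by rewrite /e; move: m0; lra.
have [|t t01 Ht] := @small_weight N [:: slen P h b; slen P h c; slen P h d;
  psi P h b d; psi P h d c; psi P h b (- c); theta12 P] (e / 4); first by rewrite divr_gt0.
have sm v : v \in [:: b; c; d] -> 0 < body (slen P h v) <= m.
  by rewrite !inE => /or3P[]/eqP->; rewrite !le_max lexx ?orbT ?sb0 ?sc0 ?sd0.
have bound_s v : v \in [:: b; c; d] -> wnorm t (slen P h v) <= 1 / 2 - e.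
  move=> vin; have /andP[v0 vm] := sm v vin.
  apply: le_trans (Ht _ _) _.
    by move: vin; rewrite !inE => /or3P[]/eqP->; rewrite eqxx ?orbT.
  have eE : e + e = 1 / 2 - m by rewrite /e; field.
  by rewrite (gtr0_norm v0); clearbody e m; move: (body _) vm => y vm; lra.
have bound_p y : y \in [:: psi P h b d; psi P h d c; psi P h b (- c)] ->
    0 <= body y <= 1 / 2 -> wnorm t y <= 1 / 2 + e / 2.
  move=> yin /andP[y0 y1]; apply: le_trans (Ht _ _) _.
    by rewrite !inE; move: yin; rewrite !inE => /or3P[]->; rewrite ?orbT.
  by rewrite (ger0_norm y0); clearbody e; move: (body y) y1 => z y1; lra.
exists t, e; split; [split=> //; first by rewrite e0|split; split=> //].
- have th0 : body (theta12 P) = 0.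
    have := body_W P 0; rewrite /Wv; case: ifP => // _; rewrite rmorphN => /eqP.
    by rewrite oppr_eq0 => /eqP.
  by have := Ht (theta12 P); rewrite th0 normr0 add0r; apply; rewrite !inE eqxx !orbT.
all: try by apply: bound_s; rewrite !inE eqxx ?orbT.
- by apply: bound_p; rewrite ?p10 ?p1 // !inE eqxx.
- by apply: bound_p; rewrite ?p20 ?p2 // !inE eqxx orbT.
- by rewrite /slen LN; apply: bound_s; rewrite !inE eqxx ?orbT.
- by apply: bound_p; rewrite ?p30 ?p3 // !inE eqxx !orbT.
Qed.

Lemma alpha_sum_half b c : edge P h b c -> forall eps : R, 0 < eps ->
  exists s0 : seq (int * int), all arcb s0 /\
    forall s : seq (int * int), uniq s -> all arcb s -> {subset s0 <= s} ->
      grnorm (evval (\sum_(v <- s) alpha P h v - ev_const N (1 / 2))) < eps.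
Proof.
move=> /(sink_exists h_pos)[b' [c' [bc Sbc]]] eps eps0 {b c}.
move: b' c' bc Sbc => b c bc Sbc; have [adj _] := bc.
have [t [e [[t01 /andP[e0 eh] th] [C1 C2 C3]]]] := sink_contracting bc Sbc.
have /andP[t0 t1] := t01; have t_ge0 := ltW t0.
have A1 : atomic P h t b c.
  by apply: atomic_split => //; apply: contracting_atomic th _ _ _; eauto.
have A2 : atomic P h t b (- c) by apply: contracting_atomic th _ _ C3.
(* Returning to the unweighted norm costs t^(-N). The total error will be 3 dl: 2 dl from the tails
   of the two intervals and dl from half of their defects. *)
pose dl := eps * t ^+ N / 4.
have dl0 : 0 < dl by rewrite divr_gt0 ?mulr_gt0 ?exprn_gt0.
have [n1 H1] := A1 dl dl0; have [n2 H2] := A2 dl dl0.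
pose n := maxn n1 n2.
have [D1 T1] := H1 n (leq_maxl _ _); have [D2 T2] := H2 n (leq_maxr _ _).
exists (farey_arcs n b c); split; first exact: farey_arcb.
move=> s us as_ sub.
have [k Hk] := sub_arcs_farey adj as_.
pose m := maxn n k; have sm := Hk m (leq_maxr _ _).
have nm : (n <= m)%N := leq_maxl _ _.
have fu j := farey_uniq j adj.
pose F v := wnorm t (alpha P h v).
have F0 v : 0 <= F v by apply: wnorm_ge0.
(* The arcs of s outside depth n lie among those of some depth m, so their norms are bounded by the
   two tails. *)
have tail : \sum_(v <- s | v \notin farey_arcs n b c) F v <= dl + dl.
  apply: (@le_trans _ _ (\sum_(v <- farey_arcs m b c | v \notin farey_arcs n b c) F v)).
    rewrite -big_filter -[leRHS]big_filter; apply: ler_sum_uniq => //; rewrite ?filter_uniq //.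
    by move=> v; rewrite !mem_filter => /andP[-> /sm].
  have := sum_uniq_split F (fu m) (fu n) (sub_farey_arcs nm).
  have Fn v : gcdz v.1 v.2 == 1 -> F (nrm v) = F v by move=> pv; rewrite /F alpha_nrm.
  rewrite !(farey_sum _ Fn adj) => eF.
  have T : (\sum_(v <- mediants m b c) F v - \sum_(v <- mediants n b c) F v)
    + (\sum_(v <- mediants m b (- c)) F v - \sum_(v <- mediants n b (- c)) F v) <= dl + dl.
    exact: lerD (T1 m nm) (T2 m nm).
  apply: le_trans T; rewrite le_eqVlt; apply/orP; left; apply/eqP.
  apply: (addrI (F b + F c + (\sum_(v <- mediants n b c) F v + \sum_(v <- mediants n b (- c)) F v))).
  by rewrite -eF; ring.
set A := \sum_(v <- s) _.
(* Half of [gap_total] is subtracted from the sum: every atom then occurs once, and what remains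
   besides the extra arcs is half of the two defects. *)
have EA : A - ev_const N (1 / 2) = \sum_(v <- s | v \notin farey_arcs n b c) alpha P h v
   - ((gap P h b c - (\sum_(v <- mediants n b c) alpha P h v + \sum_(v <- mediants n b c) alpha P h v))
    + (gap P h b (- c) - (\sum_(v <- mediants n b (- c)) alpha P h v + \sum_(v <- mediants n b (- c)) alpha P h v)))
    * ev_const N (1 / 2).
  rewrite /A (sum_uniq_split _ us (fu n) sub) (farey_sum _ alpha_nrm adj).
  rewrite -[ev_const N (1 / 2) in LHS]mul1r (gap_total h_pos bc).
  set S1 := \sum_(v <- mediants n b c) _; set S2 := \sum_(v <- mediants n b (- c)) _.
  rewrite -{1}(ev_half (alpha P h b)) -{1}(ev_half (alpha P h c)) -{1}(ev_half S1) -{1}(ev_half S2).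
  ring.
have : wnorm t (A - ev_const N (1 / 2)) <= dl * 3.
  rewrite EA; apply: le_trans (wnormB _ _ t_ge0) _.
  rewrite (_ : dl * 3 = (dl + dl) + (dl + dl) * (1 / 2)); last by field.
  apply: lerD.
    rewrite -big_filter; apply: le_trans (wnorm_sum _ _ t_ge0) _.
    by rewrite big_filter.
  have h0 : 0 <= 1 / 2 :> R by rewrite divr_ge0.
  apply: le_trans (wnormM _ _ t_ge0) _; rewrite wnorm_const ger0_norm //.
  apply: ler_wpM2r h0 _ _ _; apply: le_trans (wnormD _ _ t_ge0) _; exact: lerD.
move=> H; apply: le_lt_trans (grnorm_wnorm _ t01) _.
rewrite mulrC ltr_pdivrMr ?exprn_gt0 //; apply: le_lt_trans H _.
by move: dl0; rewrite /dl; move: (eps * _) => z; lra.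
Qed.

End Total.

Lemma mediants_gt2 N (P : STT N) (h : evgr N) n b c v : 0 < body h -> edge P h b c ->
  v \in mediants n b c -> 2 < body (L P v * h).
Proof.
move=> h0; elim: n b c => // n IH b c bc; rewrite inE mem_cat.
have db := edgeD bc; have dc : edge P h (b + c) c.
  by have := edgeC (edgeD (edgeC bc)); rewrite addrC.
case/or3P=> [/eqP->|/(IH _ _ db)|/(IH _ _ dc)] //; exact: (edge_gt2 h0 dc).
Qed.

(** Every arc is reached by flips along which h stays the semi-perimeter, so [edge_gt2] applies to
    it. *)
Lemma arc_gt2 N (P : STT N) (h : evgr N) b c v : 0 < body h -> edge P h b c ->
  arcb v -> 2 < body (L P v * h).
Proof.
move=> h0 bc av; have [adj _] := bc; have [n /mapP[u ufar vE]] := arc_farey adj av.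
rewrite vE L_nrm; last by rewrite -vE.
move: ufar; rewrite !inE mem_cat => /or4P[/eqP->|/eqP->||].
- exact: (edge_gt2 h0 bc).
- exact: (edge_gt2 h0 (edgeC bc)).
- exact: mediants_gt2.
- by apply: mediants_gt2 => //; apply: edgeNr.
Qed.

(** * Translation of the Grassmann-valued definitions into the ring of even elements *)

Section Evaluation.
Variables (N : nat) (P : STT N).

Lemma gconstE (c : R) : gconst N c = evval (ev_const N c). Proof. by []. Qed.

(** Real numerals in the definitions are read in the scope of the standard reals; these lemmas turn
    them into ring numerals. *)
Lemma IZR2 : IZR 2 = 2 :> R. Proof. by []. Qed.

Lemma IZRN4 : IZR (-4) = - 4 :> R.
Proof. by rewrite -[LHS]/(- IZR 4) IZRposE INRE. Qed.

Lemma half_real : Rdiv (IZR 1) (IZR 2) = 1 / 2.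
Proof. by rewrite RdivE IZR2. Qed.

Lemma evval_rarc (h : evgr N) v : arcb v -> r_arc P (evval h) v = evval (rarc P h v).
Proof.
move=> av; rewrite /r_arc -evval_L // -evval_W -!evM -!evN -!evD IZRN4 gconstE half_real.
rewrite -evM -evD evval_sqrt -evD evval_scale; congr (evval (_ * (_ + ev_sqrt (_ + _)))).
by rewrite rmorphN.
Qed.

Lemma evval_alpha (h : evgr N) v : 0 < body h -> arcb v -> 2 < body (L P v * h) ->
  mcshane_term P (evval h) v = evval (alpha P h v).
Proof.
move=> h0 av v2; have pv : gcdz v.1 v.2 == 1 by case/andP: av.
have Lh0 := body_Lh P h0 pv.
have r0 : 0 < body (rarc P h v) by rewrite (lt_trans ltr01) // body_rarc.
rewrite /mcshane_term evval_rarc // -evval_L // -evval_W -!evM IZR2 evval_scale.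
have u2 : 0 < body (ev_const N 2 * (L P v * h)) by rewrite rmorphM /= body_const mulr_gt0.
have u1 : 0 < body (L P v * h * rarc P h v) by rewrite rmorphM mulr_gt0.
rewrite !evval_inv ?gt_eqF // -evM -evD; congr (evval (_ + _)).
  rewrite invrM ?unit_body ?gt_eqF // mulrC; by [].
rewrite invrM ?unit_body ?body_const ?gt_eqF // mulrA; congr (_ * _).
apply: (mulIr (_ : ev_const N 2 \is a GRing.unit)).
  by rewrite unit_body body_const gt_eqF.
rewrite mulVr ?unit_body ?body_const ?gt_eqF // -(rmorphM (ev_const N)) -(rmorph1 (ev_const N)).
by congr ev_const; field.
Qed.

Lemma evval_gsum (f : int * int -> grass N) (g : int * int -> evgr N) s :
  {in s, forall v, f v = evval (g v)} -> gsum s f = evval (\sum_(v <- s) g v).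
Proof.
elim: s => [|v s IH] fg; first by rewrite big_nil.
rewrite big_cons evD -IH => [|w ws]; last by rewrite fg // inE ws orbT.
by rewrite /= fg // mem_head.
Qed.

Definition ev_superh a b c : evgr N :=
  L P a * (L P b * L P c)^-1 + L P b * (L P a * L P c)^-1 + L P c * (L P a * L P b)^-1
  + (Wv P a * (L P a)^-1 + Wv P b * (L P b)^-1 + Wv P c * (L P c)^-1).

Lemma arc_pos v : arcb v -> 0 < body (L P v).
Proof. by case/andP=> pv _; apply: L_pos. Qed.

Lemma evval_superh a b c : arcb a -> arcb b -> arcb c ->
  superh P a b c = evval (ev_superh a b c).
Proof.
move=> aa ab ac; rewrite /superh /gfrac3 -!evval_L // -!evval_W -!evM.
by rewrite !evval_inv ?rmorphM ?mulf_neq0 ?gt_eqF ?arc_pos.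
Qed.

Lemma superh_pos a b c : arcb a -> arcb b -> arcb c -> 0 < body (ev_superh a b c).
Proof.
move=> aa ab ac; rewrite /ev_superh !(rmorphD, rmorphM) /= !body_W !mul0r !addr0.
rewrite !body_inv ?rmorphM ?mulf_neq0 ?gt_eqF ?arc_pos //.
by rewrite !addr_gt0 ?divr_gt0 ?mulr_gt0 ?arc_pos.
Qed.

Lemma superh_markov a b c : arcb a -> arcb b -> arcb c ->
  ev_superh a b c * L P a * L P b * L P c =
    L P a * L P a + L P b * L P b + L P c * L P c
    + Wv P c * L P a * L P b + Wv P b * L P a * L P c + Wv P a * L P b * L P c.
Proof.
move=> aa ab ac; have u v : arcb v -> L P v \is a GRing.unit.
  by move=> av; rewrite unit_body gt_eqF // arc_pos.
rewrite /ev_superh !invrM ?u //.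
have := mulVr (u a aa); have := mulVr (u b ab); have := mulVr (u c ac).
move: (L P a)^-1 (L P b)^-1 (L P c)^-1 => ia ib ic hc hb ha.
transitivity (L P a * L P a * (ib * L P b) * (ic * L P c)
  + L P b * L P b * (ia * L P a) * (ic * L P c) + L P c * L P c * (ia * L P a) * (ib * L P b)
  + Wv P c * L P a * L P b * (ic * L P c) + Wv P b * L P a * L P c * (ib * L P b)
  + Wv P a * L P b * L P c * (ia * L P a)); first by ring.
by rewrite ha hb hc; ring.
Qed.

(** The sign of b' is chosen so that the third arc is a + b' up to sign; clearing denominators in h
    gives the Markov form. *)
Lemma superh_edge a b c : triangulation a b c ->
  exists b', edge P (ev_superh a b c) a b'.
Proof.
case=> aa ab ac [adj_ab adj_bc adj_ac].
have [b' [bE cE]] := adjacent3 adj_ab adj_bc adj_ac.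
exists b'; have Lb : L P b' = L P b by case: bE => ->; rewrite ?LN.
have Wb : Wv P b' = Wv P b by case: bE => ->; rewrite ?WN.
have Lc : L P (a + b') = L P c by case: cE => ->; rewrite ?LN.
have Wc : Wv P (a + b') = Wv P c by case: cE => ->; rewrite ?WN.
apply: markov_edge; first by case: bE => ->; rewrite ?adjacentNr.
by rewrite Lb Wb Lc Wc superh_markov.
Qed.

End Evaluation.

(* The sum over all ideal arcs converges (unconditionally, in the norm
   ||x|| = sum |x_S|) to 1/2: the net of finite partial sums tends to 1/2. *)
Theorem theorem6p5 (N : nat) (P : STT N) (a b c : int * int) :
  triangulation a b c ->
  let h := superh P a b c in
  forall eps : R, 0 < eps ->
  exists s0 : seq (int * int), all arcb s0 /\
    forall s : seq (int * int), uniq s -> all arcb s -> {subset s0 <= s} ->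
      grnorm (gadd (gsum s (mcshane_term P h)) (gconst N (- (1 / 2)))) < eps.
Proof.
move=> tri h eps eps0; have [aa ab ac _] := tri.
have hE : h = evval (ev_superh P a b c) by apply: evval_superh.
have h0 : 0 < body (ev_superh P a b c) by apply: superh_pos.
have [b' ed] := superh_edge P tri.
have [s0 [as0 Hs0]] := alpha_sum_half h0 ed eps0.
exists s0; split=> // s us as_ sub; rewrite hE.
rewrite (evval_gsum (g := alpha P (ev_superh P a b c))); last first.
  move=> v vs; have av := allP as_ _ vs.
  have [adj _] := ed; have pv : gcdz v.1 v.2 == 1 by case/andP: av.
  apply: evval_alpha => //; exact: arc_gt2 h0 ed av.
rewrite gconstE -evD rmorphN; exact: Hs0.
Qed.
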